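(* Let $k$ be a positive integer, $\epsilon\in(0,1)$ and $m>0$. Define a random pair of distributions $(p,q)$ on $[0,1]$ as follows. Pick $X\in\{0,1\}$ uniformly at random. Split the domain into $k$ consecutive macro-buckets, each of mass $1/k$ under both $p$ and $q$. For each macro-bucket independently, pick $x$ uniformly in $[0,(1-\epsilon)/k]$; the macro-bucket consists, in order, of an interval on which $p=q$ with mass $x$ under each of $p,q$, then a mini-bucket of mass $\epsilon/k$ under each of $p$ and $q$, then an interval on which $p=q$ with mass $(1-\epsilon)/k-x$ under each. If $X=1$, then $p=q$ on the mini-bucket. If $X=0$, the mini-bucket consists, in order, of an interval of mass $\epsilon/(2k)$ under $q$ and $0$ under $p$, an interval of mass $\epsilon/k$ under $p$ and $0$ under $q$, and another interval of mass $\epsilon/(2k)$ under $q$ and $0$ under $p$. (Within each of these pieces the distributions are continuous, e.g. uniform.) Let $Y$ be the random variable recording the ordering of the samples obtained by drawing $\mathrm{Poi}(m)$ independent samples from $p$ and, independently, $\mathrm{Poi}(m)$ independent samples from $q$, i.e., the sequence of labels ($p$ or $q$) of these samples listed in increasing order of value. Then there are absolute constants $c>0$ and $C'>0$ such that if $m\epsilon\le ck$, $\log(mk/\epsilon)\le c/\epsilon$ and $k\le cm$, then the mutual information satisfies $I(X:Y)\le C' m^5\epsilon^6/k^4$.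
   Context: $\mathrm{Poi}(m)$ denotes a Poisson random variable with mean $m$. $I(X:Y)$ is the mutual information between $X$ and $Y$, where all randomness (the choice of $X$, of the offsets $x$ in each macro-bucket, and of the samples) is included. *)

(* Defs.v *)
From HB Require Import structures.
From mathcomp Require Import all_boot all_order all_algebra.
From mathcomp Require Import all_classical all_reals all_analysis.

Set Implicit Arguments.
Unset Strict Implicit.
Unset Printing Implicit Defensive.

Import Order.TTheory GRing.Theory Num.Theory.
Import numFieldNormedType.Exports.

Local Open Scope classical_set_scope.
Local Open Scope ring_scope.

(* Pieces are half-open intervals so that consecutive ones are disjoint; the
   distributions below have no atoms, so endpoints carry no mass. *)
Definition common_piece (R : realType) (p q : probability (measurableTypeR R) R)
    (a b mass : R) : Prop :=
  [/\ a <= b,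
      p `]a, b]%classic = mass%:E,
      q `]a, b]%classic = mass%:E &
      forall A : set (measurableTypeR R), measurable A ->
        A `<=` `]a, b]%classic -> p A = q A].

Definition piece (R : realType) (p q : probability (measurableTypeR R) R)
    (a b mass_p mass_q : R) : Prop :=
  [/\ a <= b,
      p `]a, b]%classic = mass_p%:E &
      q `]a, b]%classic = mass_q%:E].

Definition mini_bucket (R : realType) (k : nat) (eps : R) (X : bool)
    (p q : probability (measurableTypeR R) R) (a b : R) : Prop :=
  if X then common_piece p q a b (eps / k%:R)
  else exists u v : R,
    [/\ piece p q a u 0 (eps / (2 * k%:R)),
        piece p q u v (eps / k%:R) 0 &
        piece p q v b 0 (eps / (2 * k%:R))].

Definition macro_bucket (R : realType) (k : nat) (eps : R) (X : bool) (x : R)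
    (p q : probability (measurableTypeR R) R) (l r : R) : Prop :=
  exists a b : R,
    [/\ common_piece p q l a x,
        mini_bucket k eps X p q a b &
        common_piece p q b r ((1 - eps) / k%:R - x)].

(* [bucketed k eps X x p q]: (p, q) is a possible value of the random pair when
   the hidden bit is [X] and the offset of the i-th macro-bucket is [tnth x i].
   "Continuous" is read as "without atoms"; the [s i] are the endpoints of the
   macro-buckets. *)
Definition bucketed (R : realType) (k : nat) (eps : R) (X : bool)
    (x : k.-tuple R) (p q : probability (measurableTypeR R) R) : Prop :=
  [/\ p `[0, 1]%classic = 1%E,
      q `[0, 1]%classic = 1%E,
      forall t : R, p [set t] = 0%E /\ q [set t] = 0%E &
      exists s : nat -> R,
        [/\ s 0%N = 0, s k = 1 &
            forall i : 'I_k,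
              macro_bucket k eps X (tnth x i) p q (s i) (s i.+1)]].

(* Expectation of [f] at n independent draws from mu, as an iterated integral
   (the library has no n-fold product measure on tuples). *)
Fixpoint iid_mean (R : realType) (mu : probability (measurableTypeR R) R)
    (n : nat) : (n.-tuple R -> \bar R) -> \bar R :=
  match n with
  | 0 => fun f => f [tuple]
  | n'.+1 => fun f =>
      (\int[mu]_t iid_mean mu (fun s : n'.-tuple R => f [tuple of t :: s]))%E
  end.

(* The label of a sample is [true] when it comes from p and [false] when it
   comes from q.  For distributions without atoms, ties have probability 0. *)
Definition ordering (R : realType) (us vs : seq R) : seq bool :=
  [seq z.2 | z <- sort (fun y z : R * bool => y.1 <= z.1)
                    ([seq (u, true) | u <- us] ++ [seq (v, false) | v <- vs])].

(* Probability that the ordering of Poi(m) samples from p and Poi(m) samples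
   from q is [y]. *)
Definition ordering_prob (R : realType) (m : R)
    (p q : probability (measurableTypeR R) R) (y : seq bool) : \bar R :=
  (\sum_(0 <= i <oo) \sum_(0 <= j <oo)
     (poisson_pmf m i * poisson_pmf m j)%:E *
     iid_mean p (fun us : i.-tuple R => iid_mean q (fun vs : j.-tuple R =>
       (ordering us vs == y)%:R%:E)))%E.

Lemma offset_bound_gt0 (R : realType) (k : nat) (eps : R) :
  (0 < k)%N -> 0 < eps < 1 -> 0 < (1 - eps) / k%:R.
Proof.
by move=> k0 /andP[_ e1]; rewrite divr_gt0 ?subr_gt0 ?ltr0n.
Qed.

Definition offset_law (R : realType) (k : nat) (eps : R)
    (k_gt0 : (0 < k)%N) (eps01 : 0 < eps < 1) :
    probability (measurableTypeR R) R :=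
  uniform_prob (offset_bound_gt0 k_gt0 eps01).

(* Joint probability mass function of (X, Y): X is a fair bit, the k offsets are
   i.i.d. uniform, and [p X x], [q X x] are the distributions sampled when the
   choices are [X] and [x]. *)
Definition joint_pmf (R : realType) (k : nat) (eps m : R)
    (k_gt0 : (0 < k)%N) (eps01 : 0 < eps < 1)
    (p q : bool -> k.-tuple R -> probability (measurableTypeR R) R)
    (X : bool) (y : seq bool) : R :=
  fine ((2^-1)%:E *
        iid_mean (offset_law k_gt0 eps01)
          (fun x : k.-tuple R => ordering_prob m (p X x) (q X x) y))%E.

Definition marginal_fst (R : realType) (A : finType) (B : choiceType)
    (J : A -> B -> R) (a : A) : R :=
  fine (\esum_(b in [set: B]) (J a b)%:E)%E.

Definition marginal_snd (R : realType) (A : finType) (B : choiceType)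
    (J : A -> B -> R) (b : B) : R :=
  \sum_(a : A) J a b.

(* Mutual information (in nats) of two discrete variables with joint probability
   mass function J.  The inner sum, being P(b) times the relative entropy of the
   law of the first variable given b with respect to its marginal law, is
   nonnegative, as [esum] requires.  Since ln 0 = 0, a pair with J a b = 0
   contributes 0. *)
Definition mutual_information (R : realType) (A : finType) (B : choiceType)
    (J : A -> B -> R) : \bar R :=
  (\esum_(b in [set: B])
     (\sum_(a : A)
        J a b * ln (J a b / (marginal_fst J a * marginal_snd J b)))%R%:E)%E.

(* Main.v *)
(* Up to the factor exp (-2 m) m ^ |y|, the probability of the ordering y is the
   mass of the increasing sequences of points with labels y.  This mass is
   explicit on an interval where p and q have densities 0 or 1 with respect to
   one atomless measure, and orderings on consecutive intervals concatenate.
   Hence, for each value of X, the law of Y given the offsets is a convolution,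
   over words, of the laws of the macro-buckets, and so is its average over the
   independent offsets.

   For one macro-bucket, averaging over the offset makes the position of the s
   samples of the mini-bucket uniform among the n samples of the macro-bucket.
   So the likelihood ratio minus 1 of X = 0 against X = 1 is an average, over s
   binomial and over the windows of length s of the word, of a function D of the
   window which has mean 0 and vanishes for s <= 2.  Windows at distance at
   least s are uncorrelated under X = 1, so the second moment of this average is
   O(n^5 eps^6), and the chi-square distance eta between the two laws is
   O(lam^5 eps^6), with lam = m / k.

   By Cauchy-Schwarz, chi-square distances are multiplicative for convolution,
   so the laws of Y are at chi-square distance at most (1 + eta)^k - 1, which is
   at most 2 k eta when k eta <= 1/2.  This bounds the mutual information, which
   is at most 1 in any case. *)
Require Import Defs.
From mathcomp Require Import all_boot all_order all_algebra.
From mathcomp Require Import all_classical all_reals all_analysis.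
From mathcomp Require Import measurable_realfun ring lra zify.

Set Implicit Arguments.
Unset Strict Implicit.
Unset Printing Implicit Defensive.

Import Order.TTheory GRing.Theory Num.Theory.
Import numFieldNormedType.Exports.

Local Open Scope classical_set_scope.
Local Open Scope ring_scope.

(** * Word convolutions *)

Section words.
Variable R : realType.
Implicit Types (f g : seq bool -> R) (y : seq bool) (M L x : R).

(** Convolution for concatenation: with [f] and [g] the masses of patterns on two consecutive
    intervals, the sum runs over the cut of the pattern between them. *)
Definition wconv f g y : R :=
  \sum_(i < (size y).+1) f (take i y) * g (drop i y).

Definition wone y : R := (nilp y)%:R.

(** Volume of the ordered simplex in an interval of mass [M] for both labels, whatever the letters
    of [y]. *)
Definition wcommon M y : R := M ^+ size y / (size y)`!%:R.

Definition wpure (l : bool) M y : R := (all (pred1 l) y)%:R * wcommon M y.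

Definition wmini (X : bool) M : seq bool -> R :=
  if X then wcommon M
  else wconv (wpure false (M / 2)) (wconv (wpure true M) (wpure false (M / 2))).

Definition wbucket (X : bool) L M x : seq bool -> R :=
  wconv (wcommon x) (wconv (wmini X M) (wcommon (L - x))).

(* The average of [wbucket X L M x] over x uniform in [0, L]. *)
Definition wavg (X : bool) L M y : R :=
  \sum_(s < (size y).+1) \sum_(i < (size y).+1 | (i + s <= size y)%N)
    L ^+ (size y - s) / (size y - s).+1`!%:R * wmini X M (take s (drop i y)).

Definition wpow n f : seq bool -> R := iter n (wconv f) wone.

Lemma wconv_ge0 f g y : (forall u, 0 <= f u) -> (forall u, 0 <= g u) ->
  0 <= wconv f g y.
Proof. by move=> f0 g0; apply: sumr_ge0 => i _; exact: mulr_ge0. Qed.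

Lemma wcommon_ge0 M y : 0 <= M -> 0 <= wcommon M y.
Proof. by move=> M0; rewrite mulr_ge0 ?exprn_ge0 ?invr_ge0. Qed.

Lemma wmini_ge0 X M y : 0 <= M -> 0 <= wmini X M y.
Proof.
move=> M0; have p0 l M' u : 0 <= M' -> 0 <= wpure l M' u.
  by move=> M'0; rewrite mulr_ge0// wcommon_ge0.
case: X => /=; first exact: wcommon_ge0.
have M20 : 0 <= M / 2 by rewrite divr_ge0.
by do 2?[apply: wconv_ge0 => ?]; exact: p0.
Qed.

Lemma wbucket_ge0 X L M x y : 0 <= x <= L -> 0 <= M -> 0 <= wbucket X L M x y.
Proof.
move=> /andP[x0 xL] M0; apply: wconv_ge0 => u; first exact: wcommon_ge0.
apply: wconv_ge0 => v; first exact: wmini_ge0.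
by apply: wcommon_ge0; rewrite subr_ge0.
Qed.

(** Here [s] letters lie in the mini-bucket and [i] before it. Each term depends on [x] through a
    Beta integrand, so that integration over [x] gives [wavg] up to the factor [L]. *)
Lemma wbucketE X L M x y : wbucket X L M x y =
  \sum_(s < (size y).+1) \sum_(i < (size y).+1 | (i + s <= size y)%N)
    x ^+ i / i`!%:R * ((L - x) ^+ (size y - s - i) / (size y - s - i)`!%:R) *
    wmini X M (take s (drop i y)).
Proof.
rewrite (exchange_big_dep predT)//=; apply: eq_bigr => i _.
have iy : (i <= size y)%N by rewrite -ltnS.
rewrite {1}/wcommon size_takel// mulr_sumr size_drop.
rewrite (big_ord_widen (size y).+1
  (fun s => x ^+ i / i`!%:R * (wmini X M (take s (drop i y)) *
     wcommon (L - x) (drop s (drop i y))))) ?ltnS ?leq_subr//.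
apply: eq_big => [s|s]; first by rewrite ltnS addnC; lia.
move=> _; rewrite /wcommon !size_drop -subnDA (addnC i) subnDA.
by rewrite [in RHS]mulrAC -!mulrA; congr (_ * (_ * _)); rewrite mulrC -!mulrA.
Qed.

End words.

(** * Sums over words *)

Section word_sums.
Variable R : realType.
Implicit Types (f g : seq bool -> R) (y u v : seq bool).

(** Sum over the words of length [n]. The recursion on the first letter makes splitting into a
    prefix and a suffix of fixed lengths immediate. *)
Fixpoint wsum (n : nat) f : R :=
  if n is n'.+1 then
    wsum n' (fun y => f (true :: y)) + wsum n' (fun y => f (false :: y))
  else f [::].

Lemma eq_wsum n f g : (forall y, size y = n -> f y = g y) -> wsum n f = wsum n g.
Proof.
elim: n f g => [|n IH] f g fg /=; first exact: fg.
by congr (_ + _); apply: IH => y yn; apply: fg; rewrite /= yn.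
Qed.

Lemma ler_wsum n f g : (forall y, size y = n -> f y <= g y) -> wsum n f <= wsum n g.
Proof.
elim: n f g => [|n IH] f g fg /=; first exact: fg.
by apply: lerD; apply: IH => y yn; apply: fg; rewrite /= yn.
Qed.

Lemma wsumD n f g : wsum n (fun y => f y + g y) = wsum n f + wsum n g.
Proof. by elim: n f g => [//|n IH] f g /=; rewrite !IH addrACA. Qed.

Lemma wsumZ n c f : wsum n (fun y => c * f y) = c * wsum n f.
Proof. by elim: n f => [//|n IH] f /=; rewrite !IH mulrDr. Qed.

Lemma wsum_cst n c : wsum n (fun=> c) = 2 ^+ n * c.
Proof. by elim: n => [|n IH] /=; rewrite ?mul1r// IH exprS; ring. Qed.

Lemma wsum_sum n (I : Type) (r : seq I) (P : pred I) (F : I -> seq bool -> R) :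
  wsum n (fun y => \sum_(i <- r | P i) F i y) = \sum_(i <- r | P i) wsum n (F i).
Proof. by elim: n F => [//|n IH] F /=; rewrite !IH big_split. Qed.

Lemma wsum_ge0 n f : (forall y, size y = n -> 0 <= f y) -> 0 <= wsum n f.
Proof. by move=> /ler_wsum; rewrite wsum_cst mulr0. Qed.

Lemma wsum_cat a b f :
  wsum (a + b) f = wsum a (fun u => wsum b (fun v => f (u ++ v))).
Proof. by elim: a f => [//|a IH] f /=; rewrite !IH. Qed.

Lemma wsum_take_drop n i f g : (i <= n)%N ->
  wsum n (fun y => f (take i y) * g (drop i y)) = wsum i f * wsum (n - i) g.
Proof.
move=> i_n; rewrite -{1}(subnKC i_n) wsum_cat mulrC -wsumZ; apply: eq_wsum => u ui.
rewrite mulrC -wsumZ; apply: eq_wsum => v _.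
by rewrite take_size_cat// drop_size_cat.
Qed.

Lemma wsum_wconv n f g :
  wsum n (wconv f g) = \sum_(i < n.+1) wsum i f * wsum (n - i) g.
Proof.
transitivity (\sum_(i < n.+1) wsum n (fun y => f (take i y) * g (drop i y))).
  by rewrite -wsum_sum; apply: eq_wsum => y; rewrite /wconv => ->.
by apply: eq_bigr => i _; rewrite wsum_take_drop// leq_ord.
Qed.

Lemma le_wsum y f : (forall u, 0 <= f u) -> f y <= wsum (size y) f.
Proof.
elim: y f => [//|l y IH] f f0 /=.
have Hb b : 0 <= wsum (size y) (fun u => f (b :: u)) by exact: wsum_ge0.
have := IH (fun u => f (l :: u)) (fun u => f0 _).
by case: l => /le_trans; apply; rewrite ?lerDl ?lerDr.
Qed.

(** Engel form of Cauchy-Schwarz. Since x / 0 = 0, numerators have to vanish with their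
    denominators. The sum of (a i - t b i)^2 / b i is nonnegative, and t = A / B turns this into the
    claim. *)
Lemma sqr_sum_le_titu (I : Type) (r : seq I) (P : pred I) (a b : I -> R) :
  (forall i, P i -> 0 <= b i) -> (forall i, P i -> b i = 0 -> a i = 0) ->
  (\sum_(i <- r | P i) a i) ^+ 2 / (\sum_(i <- r | P i) b i) <=
  \sum_(i <- r | P i) a i ^+ 2 / b i.
Proof.
move=> b0 ab; set A := \sum_(i <- r | P i) a i; set B := \sum_(i <- r | P i) b i.
have B0 : 0 <= B by exact: sumr_ge0.
have [->|Bn0] := eqVneq B 0.
  rewrite invr0 mulr0; apply: sumr_ge0 => i Pi.
  by rewrite divr_ge0 ?sqr_ge0 ?b0.
have expand t : \sum_(i <- r | P i) a i ^+ 2 / b i - 2 * t * A + t ^+ 2 * B =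
    \sum_(i <- r | P i) (a i - t * b i) ^+ 2 / b i.
  rewrite /A /B !mulr_sumr -sumrB -big_split; apply: eq_bigr => i Pi /=.
  have [bi0|bi0] := eqVneq (b i) 0; last by field.
  by rewrite (ab _ Pi bi0) bi0 invr0; ring.
rewrite -subr_ge0.
have -> : \sum_(i <- r | P i) a i ^+ 2 / b i - A ^+ 2 / B =
    \sum_(i <- r | P i) a i ^+ 2 / b i - 2 * (A / B) * A + (A / B) ^+ 2 * B.
  by field.
by rewrite expand; apply: sumr_ge0 => i Pi; rewrite divr_ge0 ?sqr_ge0 ?b0.
Qed.

(** Cauchy-Schwarz over the cuts of [y]: second moments of likelihood ratios are submultiplicative
    for convolution. *)
Lemma sqr_wconv_le f f' g g' y :
  (forall u, 0 <= g u) -> (forall u, 0 <= g' u) ->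
  (forall u, g u = 0 -> f u = 0) -> (forall u, g' u = 0 -> f' u = 0) ->
  wconv f f' y ^+ 2 / wconv g g' y <=
  wconv (fun u => f u ^+ 2 / g u) (fun u => f' u ^+ 2 / g' u) y.
Proof.
move=> g0 g'0 fg fg'; apply: le_trans.
  apply: sqr_sum_le_titu => i _; first exact: mulr_ge0.
  by move/eqP; rewrite mulf_eq0 => /orP[/eqP/fg->|/eqP/fg'->];
    rewrite ?mul0r ?mulr0.
by apply: ler_sum => i _; rewrite exprMn invfM mulrACA.
Qed.

(** The pairs (i, n - i) with n < N lie in the square of side N, and all terms are nonnegative. *)
Lemma cauchy_product_le N (A B : nat -> R) :
  (forall i, 0 <= A i) -> (forall i, 0 <= B i) ->
  \sum_(n < N) \sum_(i < n.+1) A i * B (n - i)%N <=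
  (\sum_(i < N) A i) * (\sum_(i < N) B i).
Proof.
move=> A0 B0.
have -> : \sum_(n < N) \sum_(i < n.+1) A i * B (n - i)%N =
    \sum_(n < N) \sum_(i < N | (i <= n)%N) A i * B (n - i)%N.
  apply: eq_bigr => n _.
  by rewrite (big_ord_widen N (fun i => A i * B (n - i)%N)).
rewrite (exchange_big_dep predT)//= mulr_suml; apply: ler_sum => i _.
rewrite -mulr_sumr ler_wpM2l//.
rewrite -(big_mkord (fun n => (i <= n)%N) (fun n => B (n - i)%N)).
rewrite -(big_mkord predT).
have -> : \sum_(0 <= n < N | (i <= n)%N) B (n - i)%N =
    \sum_(i <= n < N) B (n - i)%N by rewrite (big_nat_widenl i 0).
rewrite -{1}(add0n i) big_addn (@big_cat_nat _ _ _ (N - i)%N 0 N)//= ?leq_subr//.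
under eq_bigr do rewrite addnK.
by rewrite lerDl; apply: sumr_ge0.
Qed.

Lemma sum_exp_conv (A B : R) n :
  \sum_(i < n.+1) A ^+ i / i`!%:R * (B ^+ (n - i) / (n - i)`!%:R) =
  (A + B) ^+ n / n`!%:R.
Proof.
have fact0 k : (k`!%:R : R) != 0 by rewrite pnatr_eq0 -lt0n fact_gt0.
rewrite addrC exprDn mulr_suml; apply: eq_bigr => i _.
have i_n : (i <= n)%N by rewrite -ltnS.
rewrite -(bin_fact i_n) -mulr_natr !natrM; field.
by rewrite !fact0 pnatr_eq0 -lt0n bin_gt0 i_n.
Qed.

End word_sums.

(** * Chi-square distance of convolution powers *)

Section chi2_power.
Variable R : realType.
Variables (h0 h1 : seq bool -> R) (phi : nat -> R) (eta : R).
Hypotheses (h0_ge0 : forall y, 0 <= h0 y) (h1_ge0 : forall y, 0 <= h1 y)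
  (h01 : forall y, h1 y = 0 -> h0 y = 0)
  (wsum_h0 : forall n, wsum n h0 = phi n) (wsum_h1 : forall n, wsum n h1 = phi n)
  (phi_le1 : forall N, \sum_(n < N) phi n <= 1)
  (chi2_le : forall N, \sum_(n < N)
     wsum n (fun y => (h0 y - h1 y) ^+ 2 / h1 y) <= eta).

Let P0 k := wpow k h0.
Let P1 k := wpow k h1.

Lemma wpow_ge0 (h : seq bool -> R) k y : (forall y, 0 <= h y) -> 0 <= wpow k h y.
Proof.
move=> h_ge0; elim: k y => [|k IH] y; first by rewrite /wpow /wone /=.
exact: wconv_ge0.
Qed.

Let P01 k y : P1 k y = 0 -> P0 k y = 0.
Proof.
elim: k y => [|k IH] y //=; rewrite /P1 /P0 /= => Py.
apply: big1 => i _; have : h1 (take i y) * P1 k (drop i y) = 0.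
  apply/eqP; move/eqP: Py; rewrite psumr_eq0; last first.
    by move=> j _; rewrite mulr_ge0// wpow_ge0.
  by move/allP => /(_ i); rewrite mem_index_enum => /(_ isT).
move/eqP; rewrite mulf_eq0 => /orP[/eqP/h01->|/eqP/IH]; first by rewrite mul0r.
by rewrite /P0 => ->; rewrite mulr0.
Qed.

Let wsum_P k n : wsum n (P0 k) = wsum n (P1 k).
Proof.
elim: k n => [//|k IH] n; rewrite !wsum_wconv; apply: eq_bigr => i _.
by rewrite wsum_h0 wsum_h1 IH.
Qed.

(** Expand the square. When [f] and [g] have the same mass at length [n], the second moment of their
    ratio is this mass plus the chi-square term. *)
Let chi2E (f g : seq bool -> R) n : (forall y, g y = 0 -> f y = 0) ->
  wsum n (fun y => f y ^+ 2 / g y) =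
  wsum n (fun y => (f y - g y) ^+ 2 / g y) + 2 * wsum n f - wsum n g.
Proof.
move=> fg; rewrite -wsumZ -mulN1r -wsumZ -!wsumD; apply: eq_wsum => y _.
have [gy|gy] := eqVneq (g y) 0; last by field.
by rewrite (fg _ gy) gy invr0; ring.
Qed.

Let X k n := wsum n (fun y => P0 k y ^+ 2 / P1 k y).
Let Y k n := wsum n (fun y => (P0 k y - P1 k y) ^+ 2 / P1 k y).
Let e n := wsum n (fun y => (h0 y - h1 y) ^+ 2 / h1 y).

(** Induction on [k]. Both powers have the same mass at every length, so the second moment [X] is
    this mass plus [Y], and one more factor multiplies the total second moment by at most 1 + eta.
    Cutting at lengths below [N] keeps sums finite, and [cauchy_product_le] separates the
    factors. *)
Lemma wpow_chi2_le k N :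
  \sum_(n < N) wsum n (fun y => (wpow k h0 y - wpow k h1 y) ^+ 2 / wpow k h1 y)
  <= (1 + eta) ^+ k - 1.
Proof.
have phi0 n : 0 <= phi n by rewrite -wsum_h1; exact: wsum_ge0.
have e0 n : 0 <= e n by apply: wsum_ge0 => y _; rewrite divr_ge0// sqr_ge0.
have Y0 k' n : 0 <= Y k' n.
  by apply: wsum_ge0 => y _; rewrite divr_ge0 ?sqr_ge0// wpow_ge0.
have Pn0 k' n : 0 <= wsum n (P1 k') by apply: wsum_ge0 => y _; exact: wpow_ge0.
have P1le k' M : \sum_(n < M) wsum n (P1 k') <= 1.
  elim: k' M => [|k' IH] M.
    case: M => [|M]; first by rewrite big_ord0.
    rewrite big_ord_recl /= /P1 /wpow /= big1 ?addr0//= => i _.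
    by rewrite !(eq_wsum (g := fun=> 0)) ?wsum_cst ?mulr0 ?addr0.
  have -> : \sum_(n < M) wsum n (P1 k'.+1) =
      \sum_(n < M) \sum_(i < n.+1) phi i * wsum (n - i) (P1 k').
    by apply: eq_bigr => n _; rewrite wsum_wconv; apply: eq_bigr => i _; rewrite wsum_h1.
  apply: le_trans (cauchy_product_le _ phi0 (Pn0 k')) _.
  by rewrite mulr_ile1// sumr_ge0.
have eta0 : 0 <= eta by have := chi2_le 0; rewrite big_ord0.
have XE k' n : X k' n = wsum n (P1 k') + Y k' n.
  by rewrite /X chi2E ?wsum_P -/(Y k' n); [ring|exact: P01].
rewrite -/(\sum_(n < N) Y k n).
elim: k N => [|k IH] N.
  rewrite expr0 subrr big1// => n _; rewrite /Y /P0 /P1 /wpow /=.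
  rewrite (eq_wsum (g := fun=> 0)) ?wsum_cst ?mulr0// => y _.
  by rewrite subrr expr0n mul0r.
(* One bucket has second moment phi + e. Subtracting the mass of [P1 k.+1], which is the convolution
   of phi with the mass of [P1 k], leaves these two sums. *)
have YS n : Y k.+1 n <= \sum_(i < n.+1) phi i * Y k (n - i) +
    \sum_(i < n.+1) e i * (wsum (n - i) (P1 k) + Y k (n - i)).
  have -> : Y k.+1 n = X k.+1 n - wsum n (P1 k.+1) by rewrite XE addrC addKr.
  have XS : X k.+1 n <= \sum_(i < n.+1) (phi i + e i) * X k (n - i).
    rewrite /X; apply: le_trans.
      apply: ler_wsum => y _; apply: sqr_wconv_le => //.
      - by move=> u; exact: wpow_ge0.
      - exact: P01.
    rewrite wsum_wconv; apply: ler_sum => i _; rewrite (chi2E i h01) wsum_h0 wsum_h1.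
    by rewrite -/(e i) (_ : e i + _ - _ = phi i + e i) //; ring.
  rewrite lerBlDr; apply: le_trans XS _; rewrite [X in _ + X]wsum_wconv -!big_split /=.
  by apply: ler_sum => i _; rewrite XE wsum_h1 -/(P1 k); lra.
apply: (@le_trans _ _ (\sum_(n < N) (\sum_(i < n.+1) phi i * Y k (n - i) +
    \sum_(i < n.+1) e i * (wsum (n - i) (P1 k) + Y k (n - i))))).
  by apply: ler_sum => n _; exact: YS.
rewrite big_split /=.
have PY0 n : 0 <= wsum n (P1 k) + Y k n by exact: addr_ge0.
apply: le_trans (lerD (cauchy_product_le _ phi0 (Y0 k))
  (cauchy_product_le _ e0 PY0)) _.
rewrite [X in _ * _ + _ * X]big_split /=.
have IHN := IH N; have PN := P1le k N; have chiN := chi2_le N.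
rewrite -/(\sum_(n < N) e n) in chiN.
have : (\sum_(i < N) phi i) * (\sum_(i < N) Y k i) <= 1 * ((1 + eta) ^+ k - 1).
  by apply: ler_pM => //; apply: sumr_ge0.
have : (\sum_(i < N) e i) * (\sum_(i < N) wsum i (P1 k) + \sum_(i < N) Y k i) <=
    eta * (1 + ((1 + eta) ^+ k - 1)).
  by apply: ler_pM => //; [exact: sumr_ge0|apply: addr_ge0; exact: sumr_ge0|exact: lerD].
rewrite exprS; lra.
Qed.

End chi2_power.

(** * Deviation of a mini-bucket *)

Section mini_bucket_deviation.
Variable R : realType.
Implicit Types (y u w : seq bool) (M x : R).

Lemma eq_wconv (f f' g g' : seq bool -> R) y :
  f =1 f' -> g =1 g' -> wconv f g y = wconv f' g' y.
Proof. by move=> ff' gg'; apply: eq_bigr => i _; rewrite ff' gg'. Qed.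

Lemma wconv_scale (c d x : R) (f g : seq bool -> R) y :
  wconv (fun u => c * x ^+ size u * f u) (fun u => d * x ^+ size u * g u) y =
  c * d * x ^+ size y * wconv f g y.
Proof.
rewrite /wconv mulr_sumr; apply: eq_bigr => i _.
have -> : x ^+ size y = x ^+ size (take i y) * x ^+ size (drop i y).
  by rewrite -exprD -size_cat cat_take_drop.
ring.
Qed.

(* The factor 1 gives the right-hand side the shape of the arguments of
   [wconv_scale]. *)
Lemma wpure_scale (l : bool) M x y : wpure l (M * x) y = 1 * M ^+ size y * wpure l x y.
Proof. by rewrite /wpure /wcommon exprMn; ring. Qed.

Lemma wmini_scale X M y : wmini X M y = M ^+ size y * wmini X 1 y.
Proof.
case: X => /=; first by rewrite /wcommon expr1n mul1r.
transitivity (1 * (1 * 1) * M ^+ size y *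
    wconv (wpure false (1 / 2)) (wconv (wpure true 1) (wpure false (1 / 2))) y).
  rewrite -[1 * (1 * 1) in RHS]/(1 * (1 * 1 : R)) -wconv_scale.
  apply: eq_wconv => u; first by rewrite -wpure_scale; congr (wpure _ _ _); ring.
  rewrite -wconv_scale; apply: eq_wconv => v; rewrite -wpure_scale;
    by congr (wpure _ _ _); ring.
by rewrite !mul1r.
Qed.

Lemma wsum_wpure (l : bool) M n : wsum n (wpure l M) = M ^+ n / n`!%:R.
Proof.
have H (c : R) : wsum n (fun y => (all (pred1 l) y)%:R * c) = c.
  elim: n => [|n IH] /=; first by rewrite mul1r.
  have z : wsum n (fun y => (false && all (pred1 l) y)%:R * c) = 0.
    by rewrite (eq_wsum (g := fun=> 0)) ?wsum_cst ?mulr0// => y _; rewrite mul0r.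
  by case: (l) IH z => /= IH ->; rewrite ?addr0 ?add0r.
by rewrite -[RHS]H; apply: eq_wsum => y yn; rewrite /wpure /wcommon yn.
Qed.

(** The three pieces have total mass 1/2 + 1 + 1/2 = 2, which is also the mass of both labels
    together on a common piece of mass 1. This is why [wdev] has mean 0. *)
Lemma wsum_wmini n : wsum n (wmini false (1 : R)) = 2 ^+ n / n`!%:R.
Proof.
rewrite /= wsum_wconv.
under eq_bigr do rewrite wsum_wpure wsum_wconv.
have -> : (2 : R) ^+ n = (1 / 2 + (1 + 1 / 2)) ^+ n by congr (_ ^+ _); field.
rewrite -sum_exp_conv; apply: eq_bigr => i _; congr (_ * _).
by rewrite -sum_exp_conv; apply: eq_bigr => j _; rewrite !wsum_wpure.
Qed.

(* Likelihood ratio, minus 1, of the pattern of a mini-bucket under X = 0 with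
   respect to X = 1, given the number of its samples. *)
Definition wdev w : R := (size w)`!%:R * wmini false 1 w - 1.

Lemma wsum_wdev n : wsum n wdev = 0.
Proof.
have fact0 : (n`!%:R : R) != 0 by rewrite pnatr_eq0 -lt0n fact_gt0.
rewrite (eq_wsum (g := fun w => n`!%:R * wmini false 1 w + -1)).
  by rewrite wsumD wsumZ wsum_cst wsum_wmini; field.
by move=> w wn; rewrite /wdev wn.
Qed.

(** Source of the exponent 6 of [eps]: half of the mass of q on each side of that of p makes both
    orders of one p and one q equally likely, so a window needs three samples to deviate. The seven
    words are checked one by one. *)
Lemma wdev_small w : (size w <= 2)%N -> wdev w = 0.
Proof.
have [f0 f1 f2] : [/\ 0`! = 1%N, 1`! = 1%N & 2`! = 2%N] by [].
case: w => [|l0 [|l1 [|]]] // _; rewrite /wdev /= /wconv;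
  rewrite !big_ord_recl !big_ord0 /= /wconv ?big_ord_recl ?big_ord0 /=
    /wpure /wcommon /= ?eqxx; try case: l0; try case: l1; rewrite /= ?f0 ?f1 ?f2; by field.
Qed.

(** One word has at most the total mass 2^n / n!, so n! times its mass lies in [0, 2^n], at distance
    at most 2^n from 1. *)
Lemma wdev_sqr_le w : wdev w ^+ 2 <= 4 ^+ size w.
Proof.
have g0 : 0 <= wmini false (1 : R) w by exact: wmini_ge0.
have := @le_wsum R w (wmini false 1) (fun u => wmini_ge0 _ _ ler01).
rewrite wsum_wmini => gle; rewrite /wdev.
have f0 : 0 < ((size w)`!%:R : R) by rewrite ltr0n fact_gt0.
rewrite ler_pdivlMr// in gle.
have p1 : 1 <= (2 : R) ^+ size w by rewrite exprn_ege1// ler1n.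
have -> : (4 : R) ^+ size w = (2 ^+ size w) ^+ 2.
  by rewrite -exprM mulnC exprM; congr (_ ^+ _); ring.
rewrite -ler_sqrt ?sqr_ge0// ?exprn_ge0// !sqrtr_sqr ler_norml.
have := mulr_ge0 (ltW f0) g0; rewrite ger0_norm; last by rewrite exprn_ge0.
by move=> *; apply/andP; split; lra.
Qed.

Let window s i y := wdev (take s (drop i y)).

(** For uniform labels, disjoint windows are independent, and each has mean 0. *)
Lemma window_uncorrelated n s i j : (i + s <= j)%N -> (j + s <= n)%N ->
  wsum n (fun y => window s i y * window s j y) = 0.
Proof.
move=> isj jsn.
have -> : n = (i + (s + (n - i - s)))%N by lia.
rewrite wsum_cat (eq_wsum (g := fun=> 0)) ?wsum_cst ?mulr0// => u ui.
rewrite wsum_cat.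
transitivity (wsum s (fun w => wdev w *
    wsum (n - i - s) (fun v => wdev (take s (drop (j - i - s) v))))).
  apply: eq_wsum => w ws; rewrite -wsumZ; apply: eq_wsum => v _.
  rewrite /window drop_size_cat// take_size_cat//; congr (_ * wdev (take _ _)).
  have -> : j = ((j - i - s) + s + i)%N by lia.
  by rewrite -drop_drop drop_size_cat// -drop_drop drop_size_cat// !addnK.
by under eq_wsum do rewrite mulrC; rewrite wsumZ wsum_wdev mulr0.
Qed.

(** Overlapping windows are handled by 2 a b <= a^2 + b^2 and the uniform bound on [wdev], the
    others by [window_uncorrelated]. *)
Lemma window_covariance_le n s i j : (i + s <= n)%N -> (j + s <= n)%N ->
  wsum n (fun y => window s i y * window s j y) <=
  if (i < j + s)%N && (j < i + s)%N then 2 ^+ n * 4 ^+ s else 0.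
Proof.
move=> isn jsn; case: ifPn => [_|].
  rewrite -wsum_cst; apply: ler_wsum => y yn.
  have b l : (l + s <= n)%N -> window s l y ^+ 2 <= 4 ^+ s.
    move=> lsn; apply: le_trans (wdev_sqr_le _) _.
    by rewrite size_takel// size_drop yn; lia.
  have := b i isn; have := b j jsn.
  have := sqr_ge0 (window s i y - window s j y); nra.
rewrite negb_and -!leqNgt => /orP[jsi|isj].
  under eq_wsum do rewrite mulrC.
  by rewrite window_uncorrelated.
by rewrite window_uncorrelated.
Qed.

Let count_itv m a l : (\sum_(j < m) ((a <= j) && (j < a + l)) <= l)%N.
Proof.
suff: (\sum_(j < m) ((a <= j) && (j < a + l)) <= minn m (a + l) - a)%N by lia.
elim: m => [|m IH]; first by rewrite big_ord0.
rewrite big_ord_recr /=; move: IH; set S := (\sum_(j < m) _)%N; move: S => S.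
by rewrite /minn; case: (leqP a m) => am; case: (ltnP m (a + l)) => ml;
  case: ltnP => ml' /=; lia.
Qed.

(** Each of the n - s + 1 windows overlaps at most 2 s windows, so the second moment is linear, not
    quadratic, in their number. This turns n^6 into n^5 in the final bound. *)
Lemma window_sum_sqr_le n s : (s <= n)%N ->
  wsum n (fun y => (\sum_(i < n.+1 | (i + s <= n)%N) window s i y) ^+ 2) <=
  2 ^+ n * 4 ^+ s * (n - s).+1%:R * (2 * s%:R).
Proof.
move=> sn; have c0 : 0 <= (2 : R) ^+ n * 4 ^+ s by rewrite mulr_ge0 ?exprn_ge0.
have -> : wsum n (fun y => (\sum_(i < n.+1 | (i + s <= n)%N) window s i y) ^+ 2) =
    \sum_(i < n.+1 | (i + s <= n)%N) \sum_(j < n.+1 | (j + s <= n)%N)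
    wsum n (fun y => window s i y * window s j y).
  under [RHS]eq_bigr do rewrite -wsum_sum.
  rewrite -wsum_sum; apply: eq_wsum => y _; rewrite expr2 mulr_suml.
  by apply: eq_bigr => i _; rewrite mulr_sumr.
apply: (@le_trans _ _ (\sum_(i < n.+1 | (i + s <= n)%N)
    2 ^+ n * 4 ^+ s * (2 * s%:R))).
  apply: ler_sum => i isn.
  (* The overlapping [j] lie among 2 s consecutive integers starting at i + 1 - s, truncated at
     0. *)
  apply: (@le_trans _ _ (\sum_(j < n.+1) 2 ^+ n * 4 ^+ s *
      ((i.+1 - s <= j) && (j < i.+1 - s + 2 * s))%N%:R)).
    rewrite big_mkcond; apply: ler_sum => j _; case: ifPn => [jsn|_]; last first.
      exact: mulr_ge0.
    apply: le_trans (window_covariance_le isn jsn) _.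
    case: ifPn => [/andP[h1 h2]|_]; last exact: mulr_ge0.
    have -> : (i.+1 - s <= j)%N && (j < i.+1 - s + 2 * s)%N by lia.
    by rewrite mulr1.
  rewrite -mulr_sumr ler_wpM2l// -natr_sum -natrM ler_nat.
  exact: count_itv.
set c := 2 ^+ n * 4 ^+ s * (2 * s%:R).
rewrite (eq_bigl (fun i : 'I_n.+1 => (i < (n - s).+1)%N)); last first.
  by move=> i /=; lia.
rewrite -(big_ord_widen n.+1 (fun=> c)) ?ltnS ?leq_subr// sumr_const card_ord.
by rewrite -[leLHS]mulr_natr /c [leLHS]mulrAC.
Qed.

End mini_bucket_deviation.

(** * Chi-square distance of a macro-bucket *)

Section bucket_ratio.
Variable R : realType.
Implicit Types (y u w : seq bool).

Lemma sum_exp_coeff_le (z : R) N : 0 <= z ->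
  \sum_(n < N) z ^+ n / n`!%:R <= expR z.
Proof.
move=> z0; have := @nondecreasing_cvgn_le _ (series (exp_coeff z)).
move=> /(_ _ (is_cvg_series_exp_coeff z) N); rewrite /series /= big_mkord; apply.
apply/nondecreasing_seqP => n; rewrite /series /= big_nat_recr//= lerDl.
exact: exp_coeff_ge0.
Qed.

Lemma sum_sqr_le (I : finType) (P : pred I) (a : I -> R) :
  (forall i, P i -> 0 <= a i) ->
  \sum_(i | P i) a i ^+ 2 <= (\sum_(i | P i) a i) ^+ 2.
Proof.
move=> a0; rewrite [leRHS]expr2 mulr_suml; apply: ler_sum => i Pi.
rewrite expr2 ler_wpM2l ?a0// (bigD1 i)//= lerDl.
by apply: sumr_ge0 => j /andP[Pj _]; exact: a0.
Qed.

Variables eps : R.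
Hypothesis eps01 : 0 < eps < 1.
Let eps0 : 0 < eps. Proof. by case/andP: eps01. Qed.
Let eps1 : 0 < 1 - eps. Proof. by rewrite subr_gt0; case/andP: eps01. Qed.
Let fact0 n : (n`!%:R : R) != 0. Proof. by rewrite pnatr_eq0 -lt0n fact_gt0. Qed.

Let binw n s : R := 'C(n, s)%:R * (1 - eps) ^+ (n - s) * eps ^+ s.
Let coef n s : R := binw n s / (n - s).+1%:R.

(* The relative deviation of the law of the pattern of a macro-bucket under
   X = 0 from its law under X = 1: with s samples in the mini-bucket, a
   Binomial(n, eps) number, their position among the n samples is uniform. *)
Definition bucket_dev y : R :=
  \sum_(s < (size y).+1) \sum_(i < (size y).+1 | (i + s <= size y)%N)
    binw (size y) s / (size y - s).+1%:R * wdev R (take s (drop i y)).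

Lemma sum_windows (n s : nat) (c : R) : (s <= n)%N ->
  \sum_(i < n.+1 | (i + s <= n)%N) c = c * (n - s).+1%:R.
Proof.
move=> sn; rewrite (eq_bigl (fun i : 'I_n.+1 => (i < (n - s).+1)%N)); last first.
  by move=> i /=; lia.
by rewrite -(big_ord_widen n.+1 (fun=> c)) ?ltnS ?leq_subr// sumr_const card_ord mulr_natr.
Qed.

Let sum_binw n : \sum_(s < n.+1) binw n s = 1.
Proof.
have := exprDn (1 - eps) eps n; rewrite subrK expr1n => ->.
by apply: eq_bigr => s _; rewrite /binw -mulrA mulr_natl.
Qed.

Let sum_coef n : \sum_(s < n.+1) \sum_(i < n.+1 | (i + s <= n)%N) coef n s = 1.
Proof.
rewrite -[RHS](sum_binw n); apply: eq_bigr => s _.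
by rewrite sum_windows ?leq_ord// /coef divfK// pnatr_eq0.
Qed.

Variable tau : R.

(** As n! / (n - s + 1)! = C(n, s) s! / (n - s + 1), factoring out tau^n / n! leaves the binomial
    weight of [s], shared equally by the n - s + 1 windows, times the likelihood ratio of the
    window. *)
Let wavg_term X y s i : (i + s <= size y)%N ->
  ((1 - eps) * tau) ^+ (size y - s) / (size y - s).+1`!%:R *
    wmini X (eps * tau) (take s (drop i y)) =
  wcommon tau y * (coef (size y) s * (s`!%:R * wmini X 1 (take s (drop i y)))).
Proof.
move=> isy; rewrite wmini_scale size_takel ?size_drop; last by lia.
have sy : (s <= size y)%N by lia.
have -> : wcommon tau y = tau ^+ s * tau ^+ (size y - s) / (size y)`!%:R.
  by rewrite -exprD subnKC.
rewrite /coef /binw !exprMn factS natrM -(bin_fact sy) !natrM.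
set n := size y; field.
by rewrite !fact0 pnatr_eq0 -lt0n bin_gt0 sy /= nat1r pnatr_eq0.
Qed.

Lemma wavg_common y : wavg true ((1 - eps) * tau) (eps * tau) y = wcommon tau y.
Proof.
rewrite -[RHS]mulr1 -[X in _ = _ * X](sum_coef (size y)) mulr_sumr.
apply: eq_bigr => s _; rewrite mulr_sumr; apply: eq_bigr => i isy.
rewrite wavg_term// /= /wcommon expr1n mul1r size_takel ?size_drop; last by lia.
by rewrite mulfV// mulr1.
Qed.

Lemma wavg_dev y :
  wavg false ((1 - eps) * tau) (eps * tau) y = wcommon tau y * (1 + bucket_dev y).
Proof.
rewrite -[X in _ * (X + _)](sum_coef (size y)) -big_split mulr_sumr.
apply: eq_bigr => s _; rewrite -big_split mulr_sumr; apply: eq_bigr => i isy.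
rewrite wavg_term// /wdev size_takel ?size_drop; last by lia.
by rewrite /= /coef; ring.
Qed.

Let wsum_window n (s i : nat) : (i + s <= n)%N ->
  wsum n (fun y => wdev R (take s (drop i y))) = 0.
Proof.
move=> isn; have -> : n = (i + (s + (n - i - s)))%N by lia.
rewrite wsum_cat (eq_wsum (g := fun=> 0)) ?wsum_cst ?mulr0// => u ui.
transitivity (wsum (s + (n - i - s)) (fun y => wdev R (take s y) * 1)).
  by apply: eq_wsum => v _; rewrite mulr1 drop_size_cat.
by rewrite (wsum_take_drop _ (fun=> 1)) ?leq_addr// wsum_wdev mul0r.
Qed.

Lemma wsum_bucket_dev n : wsum n bucket_dev = 0.
Proof.
transitivity (\sum_(s < n.+1) \sum_(i < n.+1 | (i + s <= n)%N)
    wsum n (fun y => coef n s * wdev R (take s (drop i y)))).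
  rewrite (eq_wsum (g := fun y => \sum_(s < n.+1) \sum_(i < n.+1 | (i + s <= n)%N)
     coef n s * wdev R (take s (drop i y)))); last by move=> y <-.
  by rewrite wsum_sum; apply: eq_bigr => s _; rewrite wsum_sum.
by apply: big1 => s _; apply: big1 => i isn; rewrite wsumZ wsum_window ?mulr0.
Qed.

Let S n s y : R := \sum_(i < n.+1 | (i + s <= n)%N) wdev R (take s (drop i y)).

Let bucket_devE n y : size y = n -> bucket_dev y = \sum_(s < n.+1) coef n s * S n s y.
Proof. by move=> <-; apply: eq_bigr => s _; rewrite mulr_sumr. Qed.

Let S_small n s y : (s <= 2)%N -> S n s y = 0.
Proof.
move=> s2; apply: big1 => i _; apply: wdev_small.
by rewrite (leq_trans _ s2)// size_take; case: ltnP.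
Qed.

(** Cauchy-Schwarz over [s] with the weights 4^-s, whose sum is at most 2; the price is the factor
    4^s. *)
Let bucket_dev_sqr_le n y : size y = n -> bucket_dev y ^+ 2 <=
  2 * \sum_(s < n.+1) 4 ^+ s * coef n s ^+ 2 * S n s y ^+ 2.
Proof.
move=> yn; rewrite (bucket_devE yn).
set A := \sum_(s < n.+1) _; pose B : R := \sum_(s < n.+1) 4 ^- s.
pose T := \sum_(s < n.+1) (coef n s * S n s y) ^+ 2 / 4 ^- s.
have H : A ^+ 2 / B <= T.
  apply: sqr_sum_le_titu => s _; first by rewrite invr_ge0 exprn_ge0.
  by move/eqP; rewrite invr_eq0 expf_eq0 pnatr_eq0 andbF.
have -> : \sum_(s < n.+1) 4 ^+ s * coef n s ^+ 2 * S n s y ^+ 2 = T.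
  by apply: eq_bigr => s _; rewrite invrK; ring.
have B1 : 1 <= B.
  by rewrite /B big_ord_recl expr0 invr1 lerDl; apply: sumr_ge0 => i _;
    rewrite invr_ge0 exprn_ge0.
have B2 : B <= 2.
  suff BE m : \sum_(s < m) (4 : R) ^- s = 4 / 3 * (1 - 4 ^- m).
    rewrite /B BE; have : 0 <= (4 : R) ^- n.+1 by rewrite invr_ge0 exprn_ge0.
    lra.
  elim: m => [|m IHm]; first by rewrite big_ord0 expr0 invr1 subrr mulr0.
  by rewrite big_ord_recr /= IHm exprS invfM; field; rewrite expf_eq0 pnatr_eq0 andbF.
have B0 : 0 < B by exact: lt_le_trans ltr01 B1.
rewrite ler_pdivrMr// in H; apply: le_trans H _.
by rewrite mulrC ler_wpM2r//; apply: sumr_ge0 => s _; rewrite divr_ge0 ?sqr_ge0 ?invr_ge0 ?exprn_ge0.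
Qed.

(** Two bounds: C(n, s) s! <= n^s for the binomial weight, and n <= s (n - s + 1) to trade the
    number of windows for n. *)
Let coef_sqr_le n s : (0 < s <= n)%N ->
  coef n s ^+ 2 * (n - s).+1%:R <= ((n%:R * eps) ^+ s / s`!%:R) ^+ 2 * (s%:R / n%:R).
Proof.
move=> /andP[s0 sn].
have c1 : 0 <= binw n s.
  by rewrite !mulr_ge0 ?exprn_ge0// ltW.
have c2 : binw n s <= (n%:R * eps) ^+ s / s`!%:R.
  rewrite ler_pdivlMr ?ltr0n ?fact_gt0// exprMn /binw.
  have -> : 'C(n, s)%:R * (1 - eps) ^+ (n - s) * eps ^+ s * s`!%:R =
    (1 - eps) ^+ (n - s) * (('C(n, s) * s`!)%:R * eps ^+ s) by rewrite natrM; ring.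
  apply: (@le_trans _ _ (1 * (('C(n, s) * s`!)%:R * eps ^+ s))).
    rewrite ler_wpM2r//; first by rewrite mulr_ge0// exprn_ge0// ltW.
    by rewrite exprn_ile1//; [exact: ltW|rewrite gerBl ltW].
  rewrite mul1r ler_wpM2r//; first by rewrite exprn_ge0// ltW.
  rewrite bin_ffact -natrX ler_nat.
  elim: (s) => [|s' IH]; first by rewrite ffactn0.
  by rewrite ffactnSr expnSr leq_mul// leq_subr.
have n0 : 0 < (n%:R : R) by rewrite ltr0n; lia.
have N0 : 0 < ((n - s).+1%:R : R) by rewrite ltr0n.
have -> : coef n s ^+ 2 * (n - s).+1%:R = binw n s ^+ 2 * (n - s).+1%:R^-1.
  by rewrite /coef; field; rewrite nat1r pnatr_eq0.
apply: ler_pM; rewrite ?sqr_ge0 ?invr_ge0//.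
  by rewrite lerXn2r// nnegrE//; apply: le_trans c1 c2.
rewrite ler_pdivlMr// mulrC ler_pdivrMr// -natrM ler_nat.
by nia.
Qed.

(** The factor 4 in z = 4 n eps absorbs one 4^s from the Cauchy-Schwarz weights and one from the
    bound on [wdev], under the square. Only s >= 3 contributes, and a sum of squares of nonnegative
    terms is at most the square of their sum. *)
Lemma wsum_bucket_dev_sqr_le n : (0 < n)%N ->
  wsum n (fun y => bucket_dev y ^+ 2) <=
  2 ^+ n * (4 / n%:R * ((4 * (n%:R * eps)) ^+ 3 * expR (4 * (n%:R * eps))) ^+ 2).
Proof.
move=> n0; set z := 4 * (n%:R * eps).
have z0 : 0 <= z by rewrite !mulr_ge0// ltW.
have nR0 : 0 < (n%:R : R) by rewrite ltr0n.
pose a s : R := z ^+ s * s%:R / s`!%:R.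
have a0 s : 0 <= a s by rewrite divr_ge0// mulr_ge0// exprn_ge0.
have stepA : wsum n (fun y => bucket_dev y ^+ 2) <=
    2 * \sum_(s < n.+1) 4 ^+ s * coef n s ^+ 2 * wsum n (fun y => S n s y ^+ 2).
  apply: le_trans (ler_wsum (@bucket_dev_sqr_le n)) _.
  rewrite wsumZ wsum_sum ler_pM2l// ler_sum// => s _.
  by rewrite wsumZ.
have stepB (s : 'I_n.+1) : 4 ^+ s * coef n s ^+ 2 * wsum n (fun y => S n s y ^+ 2) <=
    if (3 <= s)%N then 2 ^+ n * (2 / n%:R) * a s ^+ 2 else 0.
  case: ifPn => [s3|]; last first.
    rewrite -ltnNge ltnS => s2.
    rewrite (eq_wsum (g := fun=> 0)) ?wsum_cst ?mulr0// => y _.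
    by rewrite S_small// expr0n.
  have sn : (s <= n)%N by rewrite -ltnS.
  apply: (@le_trans _ _ (4 ^+ s * coef n s ^+ 2 *
      (2 ^+ n * 4 ^+ s * (n - s).+1%:R * (2 * s%:R)))).
    apply: ler_wpM2l; last exact: window_sum_sqr_le.
    by rewrite mulr_ge0 ?sqr_ge0 ?exprn_ge0.
  have -> : 4 ^+ s * coef n s ^+ 2 * (2 ^+ n * 4 ^+ s * (n - s).+1%:R * (2 * s%:R)) =
      2 ^+ n * (2 * s%:R) * (4 ^+ s) ^+ 2 * (coef n s ^+ 2 * (n - s).+1%:R) by ring.
  have -> : 2 ^+ n * (2 / n%:R) * a s ^+ 2 = 2 ^+ n * (2 * s%:R) * (4 ^+ s) ^+ 2 *
      (((n%:R * eps) ^+ s / s`!%:R) ^+ 2 * (s%:R / n%:R)).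
    by rewrite /a /z (exprMn _ 4); field; rewrite fact0 gt_eqF.
  apply: ler_wpM2l; first by rewrite !mulr_ge0 ?exprn_ge0.
  by apply: coef_sqr_le; rewrite sn andbT; lia.
apply: le_trans stepA _.
apply: (@le_trans _ _ (2 * \sum_(s < n.+1 | (3 <= s)%N) 2 ^+ n * (2 / n%:R) * a s ^+ 2)).
  by rewrite ler_pM2l// [leRHS]big_mkcond; apply: ler_sum => s _.
clear stepB; clearbody z; rewrite -mulr_sumr.
have sumA : \sum_(s < n.+1 | (3 <= s)%N) a s <= z ^+ 3 * expR z.
  apply: (@le_trans _ _ (\sum_(s < n.+1 | (3 <= s)%N)
      z ^+ 3 * (z ^+ (s - 3) / (s - 3)`!%:R))).
    apply: ler_sum => s s3.
    have -> : a s = z ^+ 3 * (z ^+ (s - 3) * (s%:R / s`!%:R)).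
      rewrite /a -{1}(subnKC s3) exprD.
      by move: (z ^+ 3) (z ^+ (s - 3)) => v w; rewrite !mulrA.
    do 2![apply: ler_wpM2l; first exact: exprn_ge0].
    (* Here s / s! = 1 / (s - 1)! <= 1 / (s - 3)!. *)
    have -> : (s : nat) = (s - 3).+3 by lia.
    set j := (s - 3)%N; rewrite subSS subSS subSS subn0.
    rewrite factS natrM invfM mulrA divff ?mul1r ?pnatr_eq0//.
    rewrite lef_pV2 ?posrE ?ltr0n ?fact_gt0// ler_nat.
    by rewrite !factS mulnA leq_pmull.
  rewrite -mulr_sumr ler_wpM2l ?exprn_ge0//.
  rewrite -(big_mkord (fun s => (3 <= s)%N) (fun s => z ^+ (s - 3) / (s - 3)`!%:R)).
  have -> : \sum_(0 <= s < n.+1 | (3 <= s)%N) z ^+ (s - 3) / (s - 3)`!%:R =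
      \sum_(0 + 3 <= s < n.+1) z ^+ (s - 3) / (s - 3)`!%:R.
    by rewrite (big_nat_widenl 3 0).
  rewrite big_addn big_mkord; under eq_bigr do rewrite addnK.
  exact: sum_exp_coeff_le.
have sumsq : \sum_(s < n.+1 | (3 <= s)%N) a s ^+ 2 <= (z ^+ 3 * expR z) ^+ 2.
  apply: le_trans (sum_sqr_le _) _; first by move=> s _; exact: a0.
  rewrite lerXn2r ?nnegrE ?sumr_ge0//; last by rewrite mulr_ge0 ?exprn_ge0 ?expR_ge0.
have -> : 2 ^+ n * (4 / n%:R * (z ^+ 3 * expR z) ^+ 2) =
    2 * (2 ^+ n * (2 / n%:R) * (z ^+ 3 * expR z) ^+ 2) by ring.
by rewrite !ler_wpM2l// mulr_ge0 ?exprn_ge0.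
Qed.

End bucket_ratio.

(** * Poisson average over the number of samples of a macro-bucket *)

Section bucket_chi2.
Variable R : realType.

(** From exp (-x) >= 1 - x, and (1 - x) (1 + 2 x) >= 1 on [0, 1/2]. *)
Lemma expR_le_1D2x (x : R) : 0 <= x <= 1 / 2 -> expR x <= 1 + 2 * x.
Proof.
move=> /andP[x0 x1]; have := expR_ge1Dx (- x); rewrite expRN => h.
have ex := expR_gt0 x.
have {}h : (1 - x) * expR x <= 1 by rewrite -ler_pdivlMr// div1r.
have : (1 - x) * expR x <= (1 - x) * (1 + 2 * x) by nra.
by rewrite ler_pM2l//; lra.
Qed.

Variables (eps lam : R).
Hypotheses (eps01 : 0 < eps < 1) (lam_ge : 18 <= lam) (lam_eps : lam * eps <= 1 / 18).

Let eps0 : 0 < eps. Proof. by case/andP: eps01. Qed.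
Let lam0 : 0 < lam. Proof. by apply: lt_le_trans lam_ge; rewrite ltr0n. Qed.
(** Exponential cost per sample: n^5 <= 5! lam^5 exp (n / lam), and exp (4 n eps) squared is exp (8
    n eps). The constant [c0] collects 4 (4^3)^2 and 5!. *)
Let theta := lam^-1 + 8 * eps.
Let c0 : R := 4 ^+ 7 * 120.

Let theta_le : 0 <= theta <= 1 / 2.
Proof.
have lg := lam_ge; have le := lam_eps; have e0 := eps0.
 have il : 0 <= lam^-1 by rewrite invr_ge0 ltW.
have il1 : lam^-1 * lam = 1 by rewrite mulVf// gt_eqF.
have il2 : lam^-1 <= 1 / 18 by nra.
have : 18 * eps <= lam * eps by rewrite ler_wpM2r// ltW.
by rewrite /theta; move=> h; apply/andP; split; lra.
Qed.

Let term_le n : (2 * lam) ^+ n / n`!%:R / 2 ^+ n *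
    wsum n (fun y => bucket_dev eps y ^+ 2) <=
  c0 * lam ^+ 5 * eps ^+ 6 * ((2 * lam * expR theta) ^+ n / n`!%:R).
Proof.
have f0 : 0 < (n`!%:R : R) by rewrite ltr0n fact_gt0.
case: n f0 => [|n] f0.
  (* The deviation of the empty word is its own mean, hence 0. *)
  have -> : wsum 0 (fun y => bucket_dev eps y ^+ 2) = 0.
    by have := wsum_bucket_dev eps01 0; rewrite /= => ->; rewrite expr0n.
  by rewrite mulr0 /c0 !mulr_ge0 ?exprn_ge0 ?invr_ge0 ?expR_ge0 ?mulr_ge0 ?expR_ge0// ltW.
set N := n.+1 in f0 *; have N0 : 0 < (N%:R : R) by rewrite ltr0n.
have pow2 : 0 < (2 : R) ^+ N by rewrite exprn_gt0.
apply: (@le_trans _ _ ((2 * lam) ^+ N / N`!%:R / 2 ^+ N * (2 ^+ N * (4 / N%:R *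
    ((4 * (N%:R * eps)) ^+ 3 * expR (4 * (N%:R * eps))) ^+ 2)))).
  by rewrite ler_wpM2l ?wsum_bucket_dev_sqr_le// !divr_ge0 ?exprn_ge0 ?mulr_ge0// ltW.
have e8 : expR (4 * (N%:R * eps)) ^+ 2 = expR (8 * eps) ^+ N.
  by rewrite -expRM_natl -expRM_natl; congr expR; ring.
have -> : (2 * lam) ^+ N / N`!%:R / 2 ^+ N * (2 ^+ N * (4 / N%:R *
    ((4 * (N%:R * eps)) ^+ 3 * expR (4 * (N%:R * eps))) ^+ 2)) =
    (2 * lam) ^+ N / N`!%:R * (4 ^+ 7 * eps ^+ 6) * expR (8 * eps) ^+ N * N%:R ^+ 5.
  by rewrite -e8; field; rewrite !gt_eqF.
have N5 : N%:R ^+ 5 <= 120 * lam ^+ 5 * expR lam^-1 ^+ N.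
  have nl : 0 <= N%:R / lam by rewrite divr_ge0// ltW.
  rewrite -expRM_natl; have h := expR_ge1Dxn 4 nl.
  have l5 : 0 < lam ^+ 5 by rewrite exprn_gt0.
  have {}h : (N%:R / lam) ^+ 5 / 5`!%:R <= expR (N%:R / lam) by lra.
  rewrite ler_pdivrMr ?ltr0n ?fact_gt0// expr_div_n ler_pdivrMr// in h.
  apply: le_trans h _; rewrite (_ : 5`! = 120)//.
  by rewrite le_eqVlt; apply/orP; left; apply/eqP; ring.
have -> : c0 * lam ^+ 5 * eps ^+ 6 * ((2 * lam * expR theta) ^+ N / N`!%:R) =
    (2 * lam) ^+ N / N`!%:R * (4 ^+ 7 * eps ^+ 6) * expR (8 * eps) ^+ N *
    (120 * lam ^+ 5 * expR lam^-1 ^+ N).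
  by rewrite /theta expRD !exprMn /c0; field; rewrite gt_eqF.
by rewrite ler_wpM2l// !mulr_ge0 ?exprn_ge0 ?invr_ge0 ?expR_ge0 ?mulr_ge0// ltW.
Qed.

(** Summing the exponential series leaves the exponent 2 lam (exp theta - 1) <= 4 lam theta <= 4 +
    32/18, which is below 6. *)
Lemma poisson_bucket_dev_le N :
  \sum_(n < N) expR (- (2 * lam)) * (lam ^+ n / n`!%:R *
    wsum n (fun y => bucket_dev eps y ^+ 2)) <=
  c0 * expR 6 * lam ^+ 5 * eps ^+ 6.
Proof.
have cc : 0 <= c0 * lam ^+ 5 * eps ^+ 6.
  by rewrite /c0 !mulr_ge0 ?exprn_ge0// ltW.
apply: (@le_trans _ _ (\sum_(n < N) expR (- (2 * lam)) *
    (c0 * lam ^+ 5 * eps ^+ 6 * ((2 * lam * expR theta) ^+ n / n`!%:R)))).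
  apply: ler_sum => n _; rewrite ler_wpM2l ?expR_ge0//.
  apply: le_trans (term_le n); rewrite exprMn.
  rewrite (_ : lam ^+ n / n`!%:R = 2 ^+ n * lam ^+ n / n`!%:R / 2 ^+ n)//.
  by field; rewrite !expf_eq0 !pnatr_eq0 andbF -lt0n fact_gt0.
rewrite -mulr_sumr -mulr_sumr.
have z0 : 0 <= 2 * lam * expR theta by rewrite !mulr_ge0 ?expR_ge0// ltW.
apply: (@le_trans _ _ (expR (- (2 * lam)) *
    (c0 * lam ^+ 5 * eps ^+ 6 * expR (2 * lam * expR theta)))).
  by rewrite !ler_wpM2l ?expR_ge0// sum_exp_coeff_le.
have -> : expR (- (2 * lam)) * (c0 * lam ^+ 5 * eps ^+ 6 *
    expR (2 * lam * expR theta)) = c0 * lam ^+ 5 * eps ^+ 6 *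
    expR (2 * lam * expR theta - 2 * lam).
  by rewrite (expRD (2 * lam * expR theta)); ring.
have -> : c0 * expR 6 * lam ^+ 5 * eps ^+ 6 = c0 * lam ^+ 5 * eps ^+ 6 * expR 6.
  by ring.
rewrite ler_wpM2l// ler_expR.
have h := expR_le_1D2x theta_le.
have lt : lam * theta <= 1 + 8 / 18.
  by rewrite /theta mulrDr mulfV ?gt_eqF// mulrCA; have := lam_eps; lra.
have : 2 * lam * expR theta <= 2 * lam * (1 + 2 * theta).
  by rewrite ler_wpM2l// mulr_ge0// ltW.
lra.
Qed.

End bucket_chi2.

(** * Patterns of ordered samples *)

Section null_sets.
Context d (T : measurableType d) (R : realType).
Variable mu : {measure set T -> \bar R}.
Local Open Scope ereal_scope.
Import HBNNSimple.

(* The library's version also asks [f] to be measurable, which is unknown for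
   the integrands of [joint_pmf] outside the range of the offsets. *)
Lemma ge0_integral_eq_off_null (N : set T) (f g : T -> \bar R) :
  measurable N -> mu N = 0 -> measurable_fun setT g ->
  (forall x, 0 <= f x) -> (forall x, 0 <= g x) ->
  (forall x, ~ N x -> f x = g x) ->
  \int[mu]_x f x = \int[mu]_x g x.
Proof.
move=> mN N0 mg f0 g0 fg.
have mNC : measurable (~` N) by exact: measurableC.
have offN h : measurable_fun setT h -> (forall x, 0 <= h x) ->
    \int[mu]_x h x = \int[mu]_(x in ~` N) h x.
  move=> mh h0; rewrite (@ge0_negligible_integral _ _ _ mu setT N)//.
  by rewrite setTD.
apply/eqP; rewrite eq_le; apply/andP; split.
  rewrite {1}ge0_integralTE//; apply: ge_ereal_sup => _ [h /= hf <-].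
  have -> : sintegral mu h = \int[mu]_x (h x)%:E by rewrite integralT_nnsfun.
  have mh : measurable_fun setT (EFin \o h) by exact/measurable_EFinP.
  rewrite (offN (EFin \o h))//; last by move=> x; rewrite lee_fin.
  rewrite (offN g)//; apply: ge0_le_integral => //.
  - by move=> x _; rewrite /= lee_fin.
  - exact: measurable_funTS.
  - exact: measurable_funTS.
  - by move=> x Nx; rewrite /= -fg.
rewrite (offN g)// integral_mkcond ge0_integralTE; last first.
  by move=> x; rewrite patchE; case: ifP.
rewrite [leRHS]ge0_integralTE//; apply: ge_ereal_sup => _ [h /= hg <-].
apply: ereal_sup_ubound; exists h => //= x; apply: le_trans (hg x) _.
by rewrite patchE; case: ifPn => //; rewrite inE => Nx; rewrite fg.
Qed.

End null_sets.

Definition del (T : Type) (i : nat) (s : seq T) := take i s ++ drop i.+1 s.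

Lemma size_del (T : Type) (i : nat) (s : seq T) :
  (i < size s)%N -> size (del i s) = (size s).-1.
Proof. by move=> si; rewrite size_cat size_takel ?size_drop; lia. Qed.

Lemma map_del (T U : Type) (f : T -> U) i s : map f (del i s) = del i (map f s).
Proof. by rewrite map_cat map_take map_drop. Qed.

Lemma del_rcons (T : Type) i (s : seq T) x :
  (i < size s)%N -> del i (rcons s x) = rcons (del i s) x.
Proof.
move=> si; rewrite /del -!cats1 takel_cat 1?ltnW// drop_cat.
have [_|si'] := ltnP i.+1 (size s); first by rewrite catA.
have -> : i.+1 = size s by lia.
by rewrite subnn drop0 drop_size cats0.
Qed.

Lemma del_rcons_size (T : Type) (s : seq T) x : del (size s) (rcons s x) = s.
Proof.
by rewrite /del drop_oversize ?size_rcons// cats0 -cats1 take_size_cat.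
Qed.

Section ordered_samples.
Variable R : realType.
Variable mu : bool -> probability (measurableTypeR R) R.
Variable b : R.
Implicit Types (S : seq (R * bool)) (y : seq bool).
Let z0 : R * bool := (0, false).
Local Open Scope ereal_scope.

(* Mass of the increasing sequences of points of ]a, b] with labels [y] that
   contain the marked points [S], the other points being integrated against the
   measure of their label. *)
Fixpoint pattern_density y S (a : R) {struct y} : \bar R :=
  match y with
  | [::] => (nilp S)%:R%:E
  | l :: y' =>
      \int[mu l]_x (if (a < x <= b)%R then pattern_density y' S x else 0) +
      \sum_(i < size S)
        (if ((nth z0 S i).2 == l) && (a < (nth z0 S i).1 <= b)%R
         then pattern_density y' (del i S) (nth z0 S i).1 else 0)
  end.
Local Notation K := pattern_density.

Lemma pattern_density_ge0 y S a : 0 <= K y S a.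
Proof.
elim: y S a => [|l y IH] S a /=; first by rewrite lee_fin.
apply: adde_ge0; first by apply: integral_ge0 => x _; case: ifP.
by apply: sume_ge0 => i _; case: ifP.
Qed.
Hint Resolve pattern_density_ge0 : core.

(** Marks and left end depend on a parameter in an arbitrary measurable space, because the inductive
    step adds the integration variable to the parameters. *)
Lemma measurable_pattern_density y d (T : measurableType d)
    (S : seq ((T -> measurableTypeR R) * bool)) (a : T -> measurableTypeR R) :
  {in map fst S, forall g, measurable_fun setT g} ->
  measurable_fun setT a ->
  measurable_fun setT (fun t => K y [seq (g.1 t, g.2) | g <- S] (a t)).
Proof.
elim: y d T S a => [|l y IH] d T S a mS ma /=.
  by under eq_fun do rewrite /nilp size_map; exact: measurable_cst.
apply: emeasurable_funD.
  pose f (z : T * measurableTypeR R) : \bar R :=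
    if (a z.1 < z.2 <= b)%R
    then K y [seq (g.1 z.1, g.2) | g <- S] z.2 else 0.
  apply: (@measurable_fun_fubini_tonelli_F _ _ _ _ _ (mu l) f).
    rewrite /f; apply: measurable_fun_ifT.
    - apply: measurable_and.
        by apply: measurable_fun_ltr => //; exact: measurableT_comp.
      by apply: measurable_fun_ler => //; exact: measurable_cst.
    - have := IH _ _ [seq ((g.1 \o fst : T * measurableTypeR R -> _), g.2)
                     | g <- S] snd.
      under [X in _ -> _ -> measurable_fun _ X]eq_fun do
        rewrite -map_comp.
      apply => //.
      move=> g; rewrite -map_comp => /mapP[g' g'S ->] /=.
      apply: measurableT_comp => //; apply: mS; exact: map_f.
    - exact: measurable_cst.
  by move=> z; rewrite /f; case: ifP.
have -> : (fun t => \sum_(i < size [seq (g.1 t, g.2) | g <- S])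
   (if ((nth z0 [seq (g.1 t, g.2) | g <- S] i).2 == l) &&
     (a t < (nth z0 [seq (g.1 t, g.2) | g <- S] i).1 <= b)%R
   then K y (del i [seq (g.1 t, g.2) | g <- S])
     (nth z0 [seq (g.1 t, g.2) | g <- S] i).1 else 0)) =
  (fun t => \sum_(i < size S)
    (if (nth (cst 0%R, false) S i).2 == l then
     (if (a t < (nth (cst 0%R, false) S i).1 t <= b)%R
     then K y [seq (g.1 t, g.2) | g <- del i S]
       ((nth (cst 0%R, false) S i).1 t) else 0) else 0)).
  apply/funext => t; rewrite size_map; apply: eq_bigr => i _.
  by rewrite (nth_map (cst 0%R, false))//= map_del; case: (_ == l).
apply: emeasurable_sum => i; case: (_ == l); last exact: measurable_cst.
have mi : measurable_fun setT (nth (cst 0%R, false) S i).1.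
  by apply: mS; apply: map_f; exact: mem_nth.
apply: measurable_fun_ifT.
- apply: measurable_and; first exact: measurable_fun_ltr.
  by apply: measurable_fun_ler => //; exact: measurable_cst.
- apply: IH => // g /mapP[g' g'S ->]; apply: mS; apply: map_f.
  by move: g'S; rewrite mem_cat => /orP[/mem_take|/mem_drop].
- exact: measurable_cst.
Qed.


Lemma measurable_pattern_density_cst y S d (T : measurableType d)
    (a : T -> measurableTypeR R) :
  measurable_fun setT a -> measurable_fun setT (fun t => K y S (a t)).
Proof.
move=> ma; have := @measurable_pattern_density y _ _
  [seq (cst s.1 : T -> measurableTypeR R, s.2) | s <- S] _ _ ma.
rewrite (_ : (fun t => K y _ (a t)) = (fun t => K y S (a t))).
  apply=> g; rewrite -map_comp => /mapP[s _ ->] /=; exact: measurable_cst.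
apply/funext => t; rewrite -map_comp; congr (K y _ _).
by rewrite -[RHS]map_id; apply: eq_map => -[].
Qed.

Lemma measurable_pattern_density_rcons y S l d (T : measurableType d)
    (g a : T -> measurableTypeR R) :
  measurable_fun setT g -> measurable_fun setT a ->
  measurable_fun setT (fun t => K y (rcons S (g t, l)) (a t)).
Proof.
move=> mg ma; have := @measurable_pattern_density y _ _
  (rcons [seq (cst s.1 : T -> measurableTypeR R, s.2) | s <- S] (g, l)) _ _ ma.
rewrite (_ : (fun t => K y _ (a t)) = (fun t => K y (rcons S (g t, l)) (a t))).
  apply=> h; rewrite map_rcons mem_rcons inE => /orP[/eqP->//|].
  rewrite -map_comp => /mapP[s _ ->] /=; exact: measurable_cst.
apply/funext => t; rewrite map_rcons -map_comp; congr (K y (rcons _ _) _).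
by rewrite -[RHS]map_id; apply: eq_map => -[].
Qed.

(** Points are taken in increasing order beyond [a], so a mark at or before [a] can never be used
    up. *)
Lemma pattern_density_key_le y S a :
  has (fun s => (s.1 <= a)%R) S -> K y S a = 0.
Proof.
elim: y S a => [|l y IH] S a; first by case: S.
move=> /= hS; rewrite integral0_eq ?add0e.
  apply: big1 => i _; case: ifP => // /andP[_ /andP[ai _]]; apply: IH.
  move: hS; rewrite -{1}(cat_take_drop i S) (drop_nth z0)// !has_cat /=.
  case/or3P => h.
  - by apply/orP; left; apply: sub_has h => s /= /le_trans; apply; exact: ltW.
  - by move: ai; rewrite ltNge h.
  - by apply/orP; right; apply: sub_has h => s /= /le_trans; apply; exact: ltW.
move=> x _; case: ifP => // /andP[ax _]; apply: IH.
by apply: sub_has hS => s /= /le_trans; apply; exact: ltW.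
Qed.

Lemma count_del (a : pred (R * bool)) i S : (i < size S)%N ->
  count a S = (a (nth z0 S i) + count a (del i S))%N.
Proof.
move=> iS; rewrite -{1}(cat_take_drop i S) (drop_nth z0)// /del !count_cat /=; lia.
Qed.

Lemma pattern_density_count_lt y S a (l : bool) :
  (count_mem l y < count (fun s => s.2 == l) S)%N -> K y S a = 0.
Proof.
elim: y S a => [|l0 y IH] S a /= hS; first by case: S hS.
rewrite integral0_eq ?add0e; last first.
  by move=> x _; case: ifP => // _; exact: IH (leq_ltn_trans (leq_addl _ _) hS).
apply: big1 => i _; case: ifP => // /andP[/eqP il _]; apply: IH.
by move: hS; rewrite (count_del _ (ltn_ord i)) il ltn_add2l.
Qed.

(** A mark integrated against its own law becomes an ordinary point, and it may be any of the
    letters [l] of [y] that [S] leaves unmarked; the factor counts them. *)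
Lemma integral_pattern_density_rcons y S a (l : bool) :
  \int[mu l]_t K y (rcons S (t, l)) a =
  (count_mem l y - count (fun s => s.2 == l) S)%:R%:E * K y S a.
Proof.
elim: y S a => [|l0 y IH] S a /=.
  by under eq_integral do rewrite /nilp size_rcons; rewrite integral0 sub0n mul0e.
set I := \int[mu l0]_x (if (a < x <= b)%R then K y S x else 0).
(* Cases for the smallest point: in [A] it is an unmarked x, in [B] a mark of [S], in [C] the new
   mark t. *)
pose B i t := if ((nth z0 S i).2 == l0) && (a < (nth z0 S i).1 <= b)%R
  then K y (rcons (del i S) (t, l)) (nth z0 S i).1 else 0.
pose C t := if l == l0 then (if (a < t <= b)%R then K y S t else 0) else 0.
pose A t x := if (a < x <= b)%R then K y (rcons S (t, l)) x else 0.
have ltab : measurable_fun setT (fun t : measurableTypeR R => (a < t <= b)%R).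
  apply: measurable_and; first exact: measurable_fun_ltr.
  exact: measurable_fun_ler.
have mC : measurable_fun setT C.
  rewrite /C; case: eqP => // _; apply: measurable_fun_ifT => //.
  exact: measurable_pattern_density_cst.
have mB i : measurable_fun setT (B i).
  rewrite /B; case: (_ && _); last exact: measurable_cst.
  exact: (measurable_pattern_density_rcons y (del i S) l (g := id)
    (a := cst (nth z0 S i).1)).
have B0 i t : 0 <= B i t by rewrite /B; case: ifP.
have C0 t : 0 <= C t by rewrite /C; case: ifP => // _; case: ifP.
have A0 t x : 0 <= A t x by rewrite /A; case: ifP.
have mA : measurable_fun setT (fun z : measurableTypeR R * measurableTypeR R =>
    A z.1 z.2).
  apply: measurable_fun_ifT => //.
  - exact: (measurableT_comp ltab).
  - exact: (measurable_pattern_density_rcons y S l (g := fst) (a := snd)).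
transitivity (\int[mu l]_t (\int[mu l0]_x A t x +
    (\sum_(i < size S) B i t + C t))).
  apply: eq_integral => t _; congr (_ + _).
  rewrite size_rcons big_ord_recr /= nth_rcons ltnn eqxx /= del_rcons_size.
  congr (_ + _); last by rewrite /C; case: (l == l0).
  apply: eq_bigr => i _; rewrite nth_rcons ltn_ord del_rcons//.
have mAF : measurable_fun setT (fun t => \int[mu l0]_x A t x).
  by apply: (measurable_fun_fubini_tonelli_F (m2 := mu l0) _ mA) => -[].
rewrite ge0_integralD//; last 3 first.
- by move=> t _; apply: integral_ge0 => x _; exact: A0.
- by move=> t _; apply: adde_ge0 => //; apply: sume_ge0.
- by apply: emeasurable_funD => //; apply: emeasurable_sum => i; exact: mB.
rewrite ge0_integralD//; last 2 first.
- by move=> t _; apply: sume_ge0.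
- by apply: emeasurable_sum => i; exact: mB.
rewrite ge0_integral_sum//; last by move=> i; exact: mB.
rewrite (fubini_tonelli (m1 := mu l) (m2 := mu l0) (fun z => A z.1 z.2))//=.
set c := (count_mem l y - count (fun s => s.2 == l) S)%N.
have I0 : 0 <= I by apply: integral_ge0 => x _; case: ifP.
have -> : \int[mu l0]_x \int[mu l]_t A t x = c%:R%:E * I.
  rewrite /I -ge0_integralZl//; last 2 first.
  - by apply: measurable_fun_ifT => //; exact: measurable_pattern_density_cst.
  - by move=> x _; case: ifP.
  apply: eq_integral => x _; rewrite /A; case: ifP => // _.
  by rewrite integral0 mule0.
have -> : \int[mu l]_t C t = (l == l0)%:R%:E * I.
  rewrite /C /I; case: eqP => [->|_]; rewrite ?mul1e ?mul0e//.
  by rewrite integral0.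
set d := ((l0 == l) + _ - _)%N.
have nat0 n : 0 <= (n%:R : R)%:E by rewrite lee_fin.
(* Subtraction truncates at 0; when [S] has more marks [l] than [y] has letters [l], the integral
   [I] vanishes. *)
have dI : c%:R%:E * I + (l == l0)%:R%:E * I = d%:R%:E * I.
  have [cS|Sc] := leqP (count (fun s => s.2 == l) S) (count_mem l y).
    rewrite -ge0_muleDl// -EFinD -natrD eq_sym; congr (_%:R%:E * _).
    by rewrite /d /c addnC addnBA.
  rewrite /I integral0_eq ?mule0 ?adde0// => x _; case: ifP => // _.
  exact: pattern_density_count_lt Sc.
clearbody I; rewrite addeCA addeC dI ge0_muleDr//; last first.
  by apply: sume_ge0 => i _; case: ifP.
congr (_ + _); rewrite ge0_sume_distrr; last by move=> i _; case: ifP.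
apply: eq_bigr => i _; rewrite /B; case: (boolP (_ && _)); last first.
  by move=> _; rewrite integral0 mule0.
move=> /andP[/eqP il _]; rewrite IH; congr (_%:R%:E * _).
by rewrite /d (count_del _ (ltn_ord i)) il subnDl.
Qed.

End ordered_samples.

Lemma fst_inj_in (T U : eqType) (S : seq (T * U)) :
  uniq (map fst S) -> {in S &, injective fst}.
Proof.
elim: S => // s S IH /= /andP[sS uS] u v; rewrite !inE.
case/orP=> [/eqP->|uS'] /orP[/eqP->|vS'] // uv.
- by move: sS; rewrite uv map_f.
- by move: sS; rewrite -uv map_f.
- exact: IH.
Qed.

Lemma perm_del (T : eqType) (x0 : T) i S :
  (i < size S)%N -> perm_eq S (nth x0 S i :: del i S).
Proof.
move=> iS; rewrite -{1}(cat_take_drop i S) (drop_nth x0)// /del.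
by rewrite -cat1s perm_catCA.
Qed.

(** * From marked increasing sequences to the law of the ordering *)

Section ordered_samples2.
Variable R : realType.
Variable mu : bool -> probability (measurableTypeR R) R.
Variable b : R.
Implicit Types (S : seq (R * bool)) (y : seq bool).
Let z0 : R * bool := (0, false).
Local Notation K := (pattern_density mu b).
Local Notation labels S :=
  [seq z.2 | z <- sort (fun y z : R * bool => y.1 <= z.1) S].
Local Open Scope ereal_scope.

Lemma pattern_density_size_lt y S a : (size y < size S)%N -> K y S a = 0.
Proof.
elim: y S a => [|l y IH] S a /= yS; first by case: S yS.
rewrite integral0_eq ?add0e; last first.
  by move=> x _; case: ifP => // _; apply: IH; exact: ltnW.
apply: big1 => i _; case: ifP => // _; apply: IH.
by rewrite size_del// -ltnS prednK//; exact: leq_ltn_trans (ltn_ord i).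
Qed.

(** With all points marked, no letter is left for an integrated point, so the integrals vanish.
    Starting with any mark but the smallest leaves a smaller one behind and gives 0 by
    [pattern_density_key_le], so only the sorted order survives. *)
Lemma pattern_density_full y S a :
  size S = size y -> uniq (map fst S) -> all (fun s => (a < s.1 <= b)%R) S ->
  K y S a = (labels S == y)%:R%:E.
Proof.
pose le1 := fun y z : R * bool => (y.1 <= z.1)%R.
have le1_total : total le1 by move=> u v; exact: le_total.
have le1_trans : transitive le1 by move=> u v w; exact: le_trans.
elim: y S a => [|l y IH] S a; first by case: S.
move=> sizeS uS aS /=.
rewrite integral0_eq ?add0e; last first.
  by move=> x _; case: ifP => // _; apply: pattern_density_size_lt; rewrite sizeS.
rewrite -[sort _ S]/(sort le1 S).
have: perm_eq (sort le1 S) S by rewrite perm_sort.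
case: (sort le1 S) (sort_sorted le1_total S) => [|z s] /=.
  by move=> _ /perm_size; rewrite sizeS.
move=> + Ss; rewrite perm_sym in Ss; rewrite (path_sortedE le1_trans) => /andP[zs ss].
have zS : z \in S by rewrite (perm_mem Ss) mem_head.
pose i0 := Ordinal (etrans (index_mem z S) zS).
have nthi0 : nth z0 S i0 = z by exact: nth_index.
have iS (i : 'I_(size S)) : nth z0 S i \in S by exact: mem_nth.
have delS (i : 'I_(size S)) : perm_eq S (nth z0 S i :: del i S) by exact: perm_del.
have sdel : perm_eq s (del i0 S).
  rewrite -(perm_cons z); move: (delS i0); rewrite nthi0; apply: perm_trans.
  by rewrite perm_sym.
have udel : uniq (map fst (z :: del i0 S)).
  by move: (uS); rewrite (perm_uniq (perm_map fst (delS i0))) nthi0.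
have zdel : all (fun w => (z.1 < w.1)%R) (del i0 S).
  apply/allP => w wd; rewrite lt_neqAle.
  have -> : (z.1 <= w.1)%R by apply: (allP zs); rewrite (perm_mem sdel).
  rewrite andbT.
  by move: udel => /= /andP[+ _]; apply: contra => /eqP->; exact: map_f.
have lei0 (i : 'I_(size S)) : i != i0 ->
    has (fun w => (w.1 <= (nth z0 S i).1)%R) (del i S).
  move=> ii0; apply/hasP; exists z.
    move: (zS); rewrite (perm_mem (delS i)) inE => /orP[/eqP zi|//].
    have uS' : uniq S by exact: map_uniq uS.
    move/eqP: ii0; case; apply: val_inj => /=.
    by rewrite zi index_uniq.
  move: (iS i); rewrite (perm_mem Ss) inE => /orP[/eqP->//|].
  by move/allP: zs; exact.
rewrite (bigD1 i0)//= [X in _ + X]big1 ?adde0; last first.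
  by move=> i /lei0 h; case: ifP => // _; exact: pattern_density_key_le.
have /andP[az zb] := allP aS _ zS.
rewrite nthi0 az zb andbT IH; last 3 first.
- by rewrite size_del ?index_mem// sizeS.
- by case/andP: udel.
- apply/allP => w wd; rewrite (allP zdel _ wd) /=.
  suff /(allP aS)/andP[] : w \in S by [].
  by rewrite (perm_mem (delS i0)) inE wd orbT.
suff -> : sort le1 (del i0 S) = s by rewrite eqseq_cons; case: (z.2 == l).
apply: (@sorted_eq_in _ le1) => //.
- by move=> u v w _ _ _; exact: le1_trans.
- move=> u v; rewrite !mem_sort => ud vd uv; apply: (fst_inj_in uS).
  + by rewrite (perm_mem (delS i0)) inE ud orbT.
  + by rewrite (perm_mem (delS i0)) inE vd orbT.
  + exact: le_anti.
- exact: sort_sorted.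
- by rewrite perm_sort perm_sym.
Qed.

(* Iterated integral over samples with labels [ls], drawn in this order after
   the points of [S] have been drawn. *)
Fixpoint sampling_prob y S (ls : seq bool) : \bar R :=
  match ls with
  | [::] => (labels S == y)%:R%:E
  | l :: ls' => \int[mu l]_t sampling_prob y (rcons S (t, l)) ls'
  end.

Lemma sampling_prob_ge0 y S ls : 0 <= sampling_prob y S ls.
Proof.
elim: ls S => [|l ls IH] S /=; first by rewrite lee_fin.
by apply: integral_ge0 => t _.
Qed.

Hypothesis mu_itv : forall l, mu l (~` `]0%R, b]) = 0.
Hypothesis mu_set1 : forall l t, mu l [set t] = 0.

Let missed y (l : bool) S := (count_mem l y - count (fun s => s.2 == l) S)%N.

(** Induction on the labels still to be drawn, from [pattern_density_full] when none is left.
    Integrating out a draw of label [l] multiplies by the number [missed y l S] of unmarked letters,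
    and these factors build the falling factorials. *)
Lemma sampling_probE y S ls :
  uniq (map fst S) -> all (fun s => (0 < s.1 <= b)%R) S ->
  sampling_prob y S ls =
  ((size S + size ls == size y) *
    (missed y true S ^_ count_mem true ls *
     missed y false S ^_ count_mem false ls))%N%:R%:E * K y S 0%R.
Proof.
elim: ls S => [|l ls IH] S uS aS /=.
  rewrite !ffactn0 muln1 addn0; have [sS|sS] := eqVneq (size S) (size y).
    by rewrite mul1e pattern_density_full.
  rewrite mul0e; case: eqP => // e; move/negP: sS; case.
  by rewrite -e size_map size_sort.
(* Draws outside ]0, b] or equal to an earlier point are negligible; elsewhere the induction
   hypothesis applies. *)
pose N : set (measurableTypeR R) := ~` `]0%R, b] `|` [set t | t \in map fst S].
have keysE (s : seq R) : measurable ([set t | t \in s] : set (measurableTypeR R))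
    /\ mu l [set t | t \in s] = 0.
  elim: s => [|x s [mIs Is]].
    rewrite (_ : [set t | t \in [::]] = set0) ?measure0//.
    by apply/seteqP; split.
  rewrite (_ : [set t | t \in x :: s] = [set x] `|` [set t | t \in s]).
    have mx : measurable ([set x] : set (measurableTypeR R)) by [].
    by split; [exact: measurableU|rewrite measureU0//; exact: mu_set1].
  apply/seteqP; split => t /=; rewrite inE.
    by case/orP => [/eqP|]; [left|right].
  by case=> [->|->]; rewrite ?eqxx ?orbT.
have [mk k0] := keysE (map fst S).
have mb : measurable (~` `]0%R, b] : set (measurableTypeR R)).
  by apply: measurableC; exact: measurable_itv.
have mN : measurable N by exact: measurableU.
have N0 : mu l N = 0 by rewrite measureU0//; exact: mu_itv.
pose c := ((size S + (size ls).+1 == size y) *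
    ((missed y true S - (true == l)) ^_ count_mem true ls *
     (missed y false S - (false == l)) ^_ count_mem false ls))%N.
have mK : measurable_fun setT
    (fun t : measurableTypeR R => K y (rcons S (t, l)) 0%R).
  exact: (measurable_pattern_density_rcons mu b y S l (g := id) (a := cst 0%R)).
transitivity (\int[mu l]_t (c%:R%:E * K y (rcons S (t, l)) 0%R)).
  apply: (ge0_integral_eq_off_null mN N0).
  - exact: measurable_funeM.
  - by move=> t; exact: sampling_prob_ge0.
  - by move=> t; rewrite mule_ge0 ?lee_fin ?pattern_density_ge0.
  - move=> t /not_orP[/contrapT /=]; rewrite in_itv/= => tb /negP tS.
    rewrite IH.
    + congr (_%:R%:E * _); rewrite size_rcons addSn -addnS; congr (_ * _)%N.
      by rewrite /missed -!cats1 !count_cat /= !addn0 !subnDA !(eq_sym l).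
    + by rewrite map_rcons rcons_uniq tS uS.
    + by rewrite all_rcons aS tb.
rewrite ge0_integralZl ?lee_fin//; last by move=> t _; exact: pattern_density_ge0.
rewrite integral_pattern_density_rcons muleA -EFinM -natrM.
congr (_%:R%:E * _); rewrite /c -!mulnA; congr (_ * _)%N.
rewrite -/(missed y l S); case: l {c keysE k0 N0 mK} => /=; rewrite !add0n !add1n !subn0 !subn1 ffactnS; lia.
Qed.


Lemma iid_mean_labels (i j : nat) y S :
  iid_mean (mu true) (fun us : i.-tuple R => iid_mean (mu false)
    (fun vs : j.-tuple R => (labels (S ++ ([seq (u, true) | u <- us] ++
       [seq (v, false) | v <- vs])) == y)%:R%:E)) =
  sampling_prob y S (nseq i true ++ nseq j false).
Proof.
elim: i S => [|i IH] S /=.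
  elim: j S => [|j IH] S /=; first by rewrite cats0.
  apply: eq_integral => t _; rewrite -IH; congr (iid_mean _ _).
  by apply/funext => vs; rewrite cat_rcons.
apply: eq_integral => t _; rewrite -IH; congr (iid_mean _ _).
by apply/funext => us; congr (iid_mean _ _); apply/funext => vs; rewrite cat_rcons.
Qed.

Lemma nneseries_single (f : nat -> \bar R) n :
  (forall i, 0 <= f i) -> (forall i, i != n -> f i = 0) ->
  \sum_(0 <= i <oo) f i = f n.
Proof.
move=> f0 fn; rewrite (nneseries_split 0 n.+1)// add0n big_nat_recr//= big_nat.
rewrite big1 ?add0e; last by move=> i /andP[_ ii]; apply: fn; rewrite ltn_eqF.
by rewrite eseries0 ?adde0// => i ni _; apply: fn; rewrite gtn_eqF.
Qed.

(** Only the pair (i, j) of letter counts of [y] contributes. There the falling factorials are i!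
    and j!, cancelling the denominators of the Poisson weights. *)
Lemma ordering_probE (m : R) y : (0 < m)%R ->
  ordering_prob m (mu true) (mu false) y =
  (expR (- (2 * m)) * m ^+ size y)%:E * K y [::] 0%R.
Proof.
move=> m0; rewrite /ordering_prob.
have y_tf : (count_mem true y + count_mem false y = size y)%N.
  by rewrite -(count_predC (pred1 true)); congr addn; apply: eq_count => -[].
pose F i j : \bar R := (poisson_pmf m i * poisson_pmf m j)%:E *
  (((i + j == size y) * (count_mem true y ^_ i * count_mem false y ^_ j))%N%:R%:E
   * K y [::] 0%R).
have F0 i j : 0 <= F i j.
  by rewrite mule_ge0 ?lee_fin ?mulr_ge0 ?poisson_pmf_ge0// mule_ge0 ?lee_fin//
    pattern_density_ge0.
have Fz i j : (i != count_mem true y) || (j != count_mem false y) -> F i j = 0.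
  move=> ij; rewrite /F; suff -> : ((i + j == size y) *
      (count_mem true y ^_ i * count_mem false y ^_ j))%N = 0%N.
    by rewrite mul0e mule0.
  have [ijy|//] := eqVneq (i + j)%N (size y); apply/eqP; rewrite mul1n muln_eq0.
  have [ti|it] := ltnP (count_mem true y) i; first by rewrite ffact_small.
  have [fj|jf] := ltnP (count_mem false y) j.
    by rewrite [X in _ || (X == _)]ffact_small ?orbT.
  exfalso; move: ij y_tf ijy it jf; set u := count_mem true y.
  set v := count_mem false y; move: u v => u v; lia.
have inner i : \sum_(0 <= j <oo) F i j = F i (count_mem false y).
  by apply: nneseries_single => // j jf; apply: Fz; rewrite jf orbT.
transitivity (\sum_(0 <= i <oo) F i (count_mem false y)).
  apply: eq_eseriesr => i _; rewrite -inner; apply: eq_eseriesr => j _.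
  rewrite /F; congr (_ * _); have := iid_mean_labels i j y [::].
  rewrite sampling_probE// /missed /= size_cat !size_nseq add0n !count_cat !count_nseq /=.
  by rewrite !subn0 !mul0n !mul1n addn0 add0n => <-.
rewrite (@nneseries_single _ (count_mem true y))//; last first.
  by move=> i it; apply: Fz; rewrite it.
rewrite /F y_tf eqxx mul1n !ffactnn /poisson_pmf m0 muleA -EFinM.
congr (_%:E * _); rewrite -y_tf exprD natrM.
rewrite (_ : (- (2 * m) = - m + - m)%R); last by ring.
rewrite expRD; field.
by rewrite !pnatr_eq0 -!lt0n !fact_gt0.
Qed.

End ordered_samples2.

(** * Patterns on buckets *)

Section ordered_density.
Variable R : realType.
Implicit Types (y : seq bool).
Local Notation K mu b y a := (pattern_density mu b y [::] a).
Local Open Scope ereal_scope.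

Lemma pattern_density_nil_cons mu (b a : R) l y :
  K mu b (l :: y) a = \int[mu l]_x (if (a < x <= b)%R then K mu b y x else 0).
Proof. by rewrite /= big_ord0 adde0. Qed.

(** The cut is the number of points up to [b]. In the induction, a first point beyond [b] gives the
    cut 0. *)
Lemma pattern_density_split mu (a b c : R) y : (a <= b)%R -> (b <= c)%R ->
  K mu c y a =
  \sum_(i < (size y).+1) K mu b (take i y) a * K mu c (drop i y) b.
Proof.
move=> + bc; elim: y a => [|l y IH] a ab.
  by rewrite big_ord_recr big_ord0 /= add0e mul1e.
have mJ d y' (u v : R) : measurable_fun setT (fun x : measurableTypeR R =>
    if (u < x <= v)%R then K mu d y' x else 0).
  apply: measurable_fun_ifT => //; last exact: measurable_pattern_density_cst.
  apply: measurable_and; first exact: measurable_fun_ltr.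
  exact: measurable_fun_ler.
have J0 d y' u v x : 0 <= (if (u < x <= v)%R then K mu d y' x else 0).
  by case: ifP => // _; exact: pattern_density_ge0.
rewrite big_ord_recl take0 drop0 /= -/(pattern_density _ _) mul1e.
rewrite !big_ord0 !adde0 addeC.
transitivity (\int[mu l]_x ((if (a < x <= b)%R then K mu c y x else 0) +
    (if (b < x <= c)%R then K mu c y x else 0))).
  apply: eq_integral => x _; have [bx|xb] := ltP b x.
    by rewrite andbF add0e (le_lt_trans ab bx).
  by rewrite (le_trans xb bc) !andbT; case: ifP => //; rewrite adde0.
rewrite ge0_integralD//; congr (_ + _).
transitivity (\int[mu l]_x (\sum_(i < (size y).+1)
  (if (a < x <= b)%R then K mu b (take i y) x else 0) * K mu c (drop i y) b)).
  apply: eq_integral => x _; case: ifP => [/andP[ax xb]|_]; first by rewrite IH.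
  by rewrite big1// => i _; rewrite mul0e.
rewrite ge0_integral_sum//; last 2 first.
- by move=> i; apply: emeasurable_funM => //; exact: mJ.
- by move=> i x _; rewrite mule_ge0// pattern_density_ge0.
apply: eq_bigr => i _; rewrite ge0_integralZr// ?pattern_density_ge0//.
by rewrite /= big_ord0 adde0.
Qed.

Section one_measure.
Variables (nu : probability (measurableTypeR R) R) (b : R).
Hypothesis nu_set1 : forall t, nu [set t] = 0.
Let J n a := K (fun=> nu) b (nseq n true) a.

(** The mark t fits in exactly one place of an increasing sequence of n points, unless it equals one
    of them, which is negligible without atoms. *)
Let one_marked n (t a : R) :
  pattern_density (fun=> nu) b (nseq n.+1 true) [:: (t, true)] a =
  if (a < t <= b)%R then J n a else 0.
Proof.
elim: n a => [|n IH] a.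
  rewrite /= big_ord_recl big_ord0 /= adde0 integral0_eq ?add0e//.
  by move=> x _; case: ifP.
have -> : pattern_density (fun=> nu) b (nseq n.+2 true) [:: (t, true)] a =
    \int[nu]_x (if (a < x <= b)%R then
      pattern_density (fun=> nu) b (nseq n.+1 true) [:: (t, true)] x else 0) +
    (if (a < t <= b)%R then J n.+1 t else 0).
  have e y S : pattern_density (fun=> nu) b (true :: y) S a =
      \int[nu]_x (if (a < x <= b)%R then pattern_density (fun=> nu) b y S x else 0)
      + \sum_(i < size S) (if ((nth (0%R, false) S i).2 == true) &&
          (a < (nth (0%R, false) S i).1 <= b)%R
        then pattern_density (fun=> nu) b y (del i S) (nth (0%R, false) S i).1
        else 0) by [].
  by rewrite (e (nseq n.+1 true)) big_ord_recl big_ord0 adde0.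
under eq_integral do rewrite IH.
have JS u : J n.+1 u = \int[nu]_x (if (u < x <= b)%R then J n x else 0).
  exact: pattern_density_nil_cons.
have J0 u : 0 <= J n u by exact: pattern_density_ge0.
have mJ (ltab : measurableTypeR R -> bool) : measurable_fun setT ltab ->
    measurable_fun setT (fun x : measurableTypeR R => if ltab x then J n x else 0).
  move=> mab; apply: measurable_fun_ifT => //.
  exact: measurable_pattern_density_cst.
have mab (u v : R) : measurable_fun setT (fun t : measurableTypeR R => (u < t <= v)%R).
  apply: measurable_and; first exact: measurable_fun_ltr.
  exact: measurable_fun_ler.
case: ifPn => [/andP[at_ tb]|]; last first.
  rewrite negb_and -leNgt -ltNge => tab.
  rewrite integral0_eq ?add0e// => x _; case: ifP => // /andP[ax xb].
  case: ifP => // /andP[xt tb']; exfalso; case/orP: tab.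
    by rewrite leNgt (lt_trans ax xt).
  by rewrite ltNge tb'.
rewrite !JS -ge0_integralD//; last 4 first.
- by move=> x _; case: ifP => // _; case: ifP.
- rewrite (_ : (fun x => _) = fun x : measurableTypeR R =>
      if (a < x)%R && (x < t)%R then J n x else 0).
    by apply: mJ; apply: measurable_and; exact: measurable_fun_ltr.
  apply/funext => x; have [ax|] //= := ltP a x.
  have [xt|tx] := ltP x t; last by case: ifP.
  by rewrite (le_trans (ltW xt) tb) tb.
- by move=> x _; case: ifP.
- exact: mJ.
(* First points x < t come from the first integrand, x > t from the second. *)
apply: (@ge0_integral_eq_off_null _ _ _ nu [set t]) => //.
- exact: nu_set1.
- exact: mJ.
- by move=> x; apply: adde_ge0; case: ifP => // _; case: ifP.
- by move=> x; case: ifP.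
- move=> x /eqP /= xt; have [ax|xa] := ltP a x; last first.
    by rewrite /= add0e; case: ifP => // /andP[+ _]; rewrite ltNge (le_trans xa (ltW at_)).
  case: ltgtP xt => // [xt|tx] _.
    by rewrite (le_trans (ltW xt) tb) tb /= adde0.
  by rewrite /= if_same add0e.
Qed.

(** Integrating [one_marked] over the mark gives nu ]a, b] J n = (n + 1) J (n + 1), hence the volume
    of the simplex by induction. *)
Lemma pattern_density_atomless n (a : R) : (a <= b)%R ->
  J n a = (wcommon (fine (nu `]a, b]%classic)) (nseq n true))%:E.
Proof.
move=> ab; elim: n => [|n IH]; first by rewrite /wcommon /= expr0 divr1.
have := integral_pattern_density_rcons (fun=> nu) b (nseq n.+1 true) [::] a true.
rewrite subn0 count_nseq mul1n.
under eq_integral do rewrite one_marked.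
rewrite -/(J n.+1 a) => e.
have {e} : (fine (nu `]a, b]%classic))%:E * J n a = n.+1%:R%:E * J n.+1 a.
  rewrite -e fineK; last exact: fin_num_measure.
  have -> : \int[nu]_t (if (a < t <= b)%R then J n a else 0) =
      \int[nu]_t (J n a * (\1_(`]a, b]%classic) t)%:E).
    apply: eq_integral => t _; rewrite indicE mem_setE in_itv/=.
    by case: ifP; rewrite ?mule1 ?mule0.
  have m1 : measurable_fun setT
      (fun t : measurableTypeR R => (\1_(`]a, b]%classic) t : R)%:E).
    by apply/measurable_EFinP; apply: measurable_indic; exact: measurable_itv.
  rewrite ge0_integralZl ?pattern_density_ge0//.
  by rewrite integral_indic// setIT muleC.
rewrite IH => e; have : n.+1%:R^-1%:E * (n.+1%:R%:E * J n.+1 a) = J n.+1 a.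
  by rewrite muleA -EFinM mulVf ?mul1e// pnatr_eq0.
rewrite -e -EFinM => <-; congr _%:E; rewrite /wcommon !size_nseq factS exprS natrM.
by rewrite invfM; ring.
Qed.

End one_measure.

Lemma pattern_density_itv mu (b a : R) l y :
  K mu b (l :: y) a = \int[mu l]_(x in `]a, b]) K mu b y x.
Proof.
rewrite pattern_density_nil_cons [RHS]integral_mkcond; apply: eq_integral => x _.
by rewrite patchE mem_setE in_itv.
Qed.

(** [w] selects the labels whose law is [nu] on the piece; the others do not charge it. The left end
    [a'] moves in the induction. *)
Lemma pattern_density_piece (mu : bool -> probability (measurableTypeR R) R)
    (nu : probability (measurableTypeR R) R)
    (w : pred bool) (a b a' : R) y :
  (forall t, nu [set t] = 0) ->
  (forall l (A : set (measurableTypeR R)), measurable A -> A `<=` `]a, b]%classic ->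
    mu l A = if w l then nu A else 0) ->
  (a <= a' <= b)%R ->
  K mu b y a' = ((all w y)%:R * wcommon (fine (nu `]a', b]%classic)) y)%:E.
Proof.
move=> nu1 mu_nu /andP[aa' a'b].
transitivity ((all w y)%:R%:E * K (fun=> nu) b (nseq (size y) true) a'); last first.
  by rewrite pattern_density_atomless// -EFinM /wcommon size_nseq.
elim: y a' aa' a'b => [|l y IH] a' aa' a'b; first by rewrite /= mul1e.
have itvS : `]a', b]%classic `<=` (`]a, b]%classic : set R).
  by move=> x /=; rewrite !in_itv/= => /andP[/(le_lt_trans aa')-> ->].
have mitv : measurable (`]a', b]%classic : set (measurableTypeR R)).
  exact: measurable_itv.
have mK mu' y' : measurable_fun (`]a', b]%classic : set (measurableTypeR R))
    (fun x : measurableTypeR R => K mu' b y' x).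
  by apply: measurable_funTS; exact: measurable_pattern_density_cst.
rewrite -[nseq _ true]/(true :: nseq (size y) true) !pattern_density_itv.
have [wl|wl] := boolP (w l); last first.
  have l0 : mu l `]a', b]%classic = 0 by rewrite mu_nu// (negbTE wl).
  by rewrite (null_set_integral mitv (mK mu y) l0) /= (negbTE wl) mul0e.
rewrite /= wl (eq_measure_integral nu); last first.
  by move=> A mA Aitv; have := mu_nu l A mA (subset_trans Aitv itvS); rewrite wl.
rewrite -ge0_integralZl ?lee_fin//; last first.
  by move=> x _; exact: pattern_density_ge0.
apply: eq_integral => x; rewrite inE/= in_itv/= => /andP[ax xb].
by rewrite IH// (le_trans aa' (ltW ax)).
Qed.

Lemma pattern_density_concat mu (a b c : R) (f g : seq bool -> R) y :
  (a <= b)%R -> (b <= c)%R ->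
  (forall y, K mu b y a = (f y)%:E) -> (forall y, K mu c y b = (g y)%:E) ->
  K mu c y a = (wconv f g y)%:E.
Proof.
move=> ab bc fE gE; rewrite (pattern_density_split mu y ab bc) -sumEFin.
by apply: eq_bigr => i _; rewrite fE gE EFinM.
Qed.

End ordered_density.

Section buckets.
Variable R : realType.
Implicit Types (y : seq bool).
Local Notation K mu b y a := (pattern_density mu b y [::] a).
Variables p q : probability (measurableTypeR R) R.
Hypothesis atomless : forall t : R, p [set t] = 0%E /\ q [set t] = 0%E.
Let mu (l : bool) := if l then p else q.

Lemma common_piece_density (a b M : R) y :
  common_piece p q a b M -> K mu b y a = (wcommon M y)%:E.
Proof.
move=> [ab pM qM pq].
rewrite (@pattern_density_piece _ mu p predT a b) ?lexx//.
- by rewrite all_predT mul1r pM.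
- by move=> t; case: (atomless t).
- by move=> [] A mA Aab //=; rewrite pq.
Qed.

Lemma pure_piece_density (l : bool) (a b M : R) y :
  piece p q a b (if l then M else 0) (if l then 0 else M) ->
  K mu b y a = (wpure l M y)%:E.
Proof.
move=> [ab pM qM].
have mitv : measurable (`]a, b]%classic : set (measurableTypeR R)).
  exact: measurable_itv.
have lM : mu l `]a, b]%classic = M%:E by rewrite /mu; case: (l) pM qM.
have l0 : mu (~~ l) `]a, b]%classic = 0%E by rewrite /mu; case: (l) pM qM.
rewrite (@pattern_density_piece _ mu (mu l) (pred1 l) a b) ?lexx//.
- by rewrite lM.
- by move=> t; rewrite /mu; case: (l); case: (atomless t).
- move=> l' A mA Aab /=; case: eqP => [->//|l'l].
  have -> : l' = ~~ l by case: (l) (l') l'l => [] [].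
  by apply/eqP; rewrite eq_le measure_ge0 andbT -l0 le_measure// inE.
Qed.

Variables (k : nat) (eps : R).

Lemma mini_bucket_density X (a b : R) y :
  mini_bucket k eps X p q a b ->
  (a <= b)%R /\ K mu b y a = (wmini X (eps / k%:R) y)%:E.
Proof.
case: X => [H|[u [v [H1 H2 H3]]]].
  by split; [case: H|exact: common_piece_density].
have [au _ _] := H1; have [uv _ _] := H2; have [vb _ _] := H3.
split; first exact: le_trans (le_trans au uv) vb.
have halfM : eps / (2 * k%:R) = eps / k%:R / 2 :> R by rewrite invfM mulrA mulrAC.
rewrite halfM in H1 H3.
apply: (pattern_density_concat y au (le_trans uv vb)) => {}y.
  exact: (@pure_piece_density false).
apply: (pattern_density_concat y uv vb) => {}y.
  exact: (@pure_piece_density true).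
exact: (@pure_piece_density false).
Qed.

Lemma macro_bucket_density X x (l r : R) y :
  macro_bucket k eps X x p q l r ->
  (l <= r)%R /\
  K mu r y l = (wbucket X ((1 - eps) / k%:R) (eps / k%:R) x y)%:E.
Proof.
move=> [a [b [H1 H2 H3]]].
have [la _ _ _] := H1; have [br _ _ _] := H3.
have [ab _] := mini_bucket_density [::] H2.
split; first exact: le_trans (le_trans la ab) br.
apply: (pattern_density_concat y la (le_trans ab br)) => {}y.
  exact: common_piece_density.
apply: (pattern_density_concat y ab br) => {}y.
  by case: (mini_bucket_density y H2).
exact: common_piece_density.
Qed.

Definition wbuckets X L M (x : seq R) : seq bool -> R :=
  foldr (fun t => wconv (wbucket X L M t)) (@wone R) x.

Lemma pattern_density_empty (a : R) y : K mu a y a = (wone R y)%:E.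
Proof.
case: y => [//|l y]; rewrite pattern_density_itv set_itv_ge ?integral_set0//.
by rewrite bnd_simp ltxx.
Qed.

Lemma buckets_density X (s : nat -> R) (x : seq R) n0 y :
  (forall i, (i < size x)%N ->
    macro_bucket k eps X (nth 0 x i) p q (s (n0 + i)%N) (s (n0 + i).+1)) ->
  (s n0 <= s (n0 + size x)%N)%R /\
  K mu (s (n0 + size x)%N) y (s n0) =
  (wbuckets X ((1 - eps) / k%:R) (eps / k%:R) x y)%:E.
Proof.
elim: x n0 y => [|t x IH] n0 y H; first by rewrite addn0 pattern_density_empty.
have [] := IH n0.+1 [::] _; first by move=> i ix; have := H i.+1 ix; rewrite addnS.
rewrite addSnnS => les _.
have Ht := H 0%N isT; rewrite addn0 /= in Ht.
have [lest _] := macro_bucket_density [::] Ht.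
split; first exact: le_trans les.
apply: (pattern_density_concat y lest les) => {}y.
  by case: (macro_bucket_density y Ht).
have [|_] := IH n0.+1 y; last by rewrite addSnnS.
by move=> i ix; have := H i.+1 ix; rewrite addnS.
Qed.

Lemma ordering_prob_bucketed (m : R) X (x : k.-tuple R) y : 0 < m ->
  bucketed eps X x p q ->
  ordering_prob m p q y =
  (expR (- (2 * m)) * m ^+ size y *
   wbuckets X ((1 - eps) / k%:R) (eps / k%:R) x y)%:E.
Proof.
move=> m0 [p1 q1 _ [s [s0 sk Hs]]].
have [] := @buckets_density X s x 0 y.
  move=> i ix; rewrite add0n; have ik : (i < k)%N by rewrite -(size_tuple x).
  by have := Hs (Ordinal ik); rewrite (tnth_nth 0).
rewrite add0n size_tuple s0 sk => _ KE.
rewrite (@ordering_probE _ mu 1)//.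
- by rewrite KE -EFinM.
- move=> l; have m01 : measurable (`]0, 1]%classic : set (measurableTypeR R)).
    exact: measurable_itv.
  have mu01 : mu l `]0, 1]%classic = 1%E.
    have : mu l `[0, 1]%classic = 1%E by case: l.
    rewrite -(@setU1itv _ _ (BRight 1) 0 false) ?bnd_simp//= setUC measureU0//.
    by case: (atomless 0); rewrite /mu; case: (l).
  by rewrite probability_setC// mu01 subee.
- by move=> l t; rewrite /mu; case: l; case: (atomless t).
Qed.

End buckets.

(** * Averaging over the offsets *)

Section beta_integral.
Variable R : realType.
Notation leb := (@lebesgue_measure R).
Implicit Types (a b L x : R).

Let is_derive_LRcontinuous (F f : R -> R) a b :
  (forall x, is_derive x 1 F (f x)) ->
  derivable_oo_LRcontinuous F a b /\ {in `]a, b[, F^`()%classic =1 f}.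
Proof.
move=> dF.
have cF x : {for x, continuous F}.
  by apply: differentiable_continuous; apply/derivable1_diffP; case: (dF x).
split; last by move=> x _; rewrite derive1E; apply: derive_val.
split.
- by move=> x _; case: (dF x).
- by apply: cvg_at_right_filter; exact: cF.
- by apply: cvg_at_left_filter; exact: cF.
Qed.

(** Normalized Beta integral: integration by parts moves one power from L - x to x, and the boundary
    terms vanish. *)
Lemma integral_exp_fact L (i j : nat) : 0 < L ->
  (\int[leb]_(x in `[0%R, L]) (x ^+ i / i`!%:R * ((L - x) ^+ j / j`!%:R))%:E =
  (L ^+ (i + j).+1 / (i + j).+1`!%:R)%:E)%E.
Proof.
move=> L0.
have fact0 n : (n`!%:R : R) != 0 by rewrite pnatr_eq0 -lt0n fact_gt0.
pose G n x : R := x ^+ n.+1 / n.+1`!%:R.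
pose F n x : R := (L - x) ^+ n.+1 / n.+1`!%:R.
have dG n x : is_derive x 1 (G n) (x ^+ n / n`!%:R).
  have -> : G n = (n.+1`!%:R^-1 \*: (id ^+ n.+1 : R -> R)).
    by apply/funext => z; rewrite /G /= mulrC exprfctE.
  apply: is_derive_eq; rewrite factS natrM /GRing.scale /= mulr1.
  by field; rewrite fact0 nat1r pnatr_eq0.
have dF n x : is_derive x 1 (F n) (- ((L - x) ^+ n / n`!%:R)).
  have -> : F n = (n.+1`!%:R^-1 \*: ((cst L - id) ^+ n.+1 : R -> R)).
    by apply/funext => z; rewrite /F /= mulrC exprfctE.
  apply: is_derive_eq; rewrite factS natrM /GRing.scale /= sub0r.
  by field; rewrite fact0 nat1r pnatr_eq0.
have cvX n x : {for x, continuous (fun z : R => z ^+ n / n`!%:R)}.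
  by apply: cvgM; [exact: exprn_continuous|exact: cvg_cst].
have cvLX n x : {for x, continuous (fun z : R => - ((L - z) ^+ n / n`!%:R))}.
  apply: cvgN; apply: cvgM; last exact: cvg_cst.
  apply: (@continuous_comp _ _ _ (fun z : R => L - z) (fun z => z ^+ n)).
    by apply: cvgB; [exact: cvg_cst|exact: cvg_id].
  exact: exprn_continuous.
elim: j i => [|j IH] i.
  under eq_integral do rewrite expr0 divr1 mulr1.
  rewrite (continuous_FTC2 (F := G i))//.
  - by rewrite /G expr0n mul0r addn0 sube0.
  - by apply: continuous_in_subspaceT => x _; exact: cvX.
  - by case: (is_derive_LRcontinuous 0 L (dG i)).
  - by case: (is_derive_LRcontinuous 0 L (dG i)).
under eq_integral do rewrite mulrC -[X in (X * _)%:E]/(F j _).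
have [dFo eF] := is_derive_LRcontinuous 0 L (dF j).
have [dGo eG] := is_derive_LRcontinuous 0 L (dG i).
rewrite (@integration_by_parts _ (F j) (G i) (fun x => - ((L - x) ^+ j / j`!%:R))
  (fun x => x ^+ i / i`!%:R))//; last 2 first.
- by apply: continuous_in_subspaceT => x _; exact: cvLX.
- by apply: continuous_in_subspaceT => x _; exact: cvX.
rewrite /F /G subrr !expr0n /= !mul0r mulr0 subrr sub0e.
rewrite -addSnnS -IH -[RHS]oppeK; congr (- _)%E; rewrite -integral_ge0N; last first.
  move=> x /=; rewrite in_itv/= => /andP[x0 xL].
  by rewrite lee_fin !mulr_ge0 ?exprn_ge0 ?invr_ge0 ?subr_ge0.
by apply: eq_integral => x _; rewrite -EFinN; congr _%:E; ring.
Qed.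

End beta_integral.

Lemma iid_mean_ge0 (R : realType) (mu : probability (measurableTypeR R) R) n
    (f : n.-tuple R -> \bar R) :
  (forall x, 0 <= f x)%E -> (0 <= iid_mean mu f)%E.
Proof.
elim: n f => [|n IH] f f0 //=; apply: integral_ge0 => t _.
by apply: IH => x; exact: f0.
Qed.

Section offsets.
Variables (R : realType) (X : bool) (L M : R) (L_gt0 : 0 < L).
Hypothesis M_ge0 : 0 <= M.
Notation leb := (@lebesgue_measure R).
Let U : probability (measurableTypeR R) R := uniform_prob L_gt0.
Let B t := wbucket X L M t.

Let measurable_wbucket y : measurable_fun setT (fun t : measurableTypeR R => B t y).
Proof.
under eq_fun do rewrite /B wbucketE.
apply: measurable_sum => s; under eq_fun do rewrite big_mkcond.
apply: measurable_sum => i; case: (_ <= _)%N; last exact: measurable_cst.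
apply: measurable_funM; last exact: measurable_cst.
apply: measurable_funM.
  by apply: measurable_funM; [exact: measurable_funX|exact: measurable_cst].
apply: measurable_funM; last exact: measurable_cst.
by apply: measurable_funX; apply: measurable_funB.
Qed.

Let integral_wbucket y :
  (\int[leb]_(x in `[0%R, L]) (B x y)%:E = (L * wavg X L M y)%:E)%E.
Proof.
have L0 : 0 <= L by exact: ltW.
pose T s i x : R := if (i + s <= size y)%N then
  x ^+ i / i`!%:R * ((L - x) ^+ (size y - s - i) / (size y - s - i)`!%:R) *
    wmini X M (take s (drop i y)) else 0.
have mT s i : measurable_fun (`[0%R, L]%classic : set (measurableTypeR R))
    (fun x : measurableTypeR R => (T s i x)%:E).
  apply: measurable_funTS; apply/measurable_EFinP; rewrite /T.
  case: (_ <= _)%N; last exact: measurable_cst.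
  apply: measurable_funM; last exact: measurable_cst.
  apply: measurable_funM.
    by apply: measurable_funM; [exact: measurable_funX|exact: measurable_cst].
  apply: measurable_funM; last exact: measurable_cst.
  by apply: measurable_funX; apply: measurable_funB.
have T0 s i x : `[0%R, L]%classic x -> (0 <= (T s i x)%:E)%E.
  rewrite /= in_itv/= => /andP[x0 xL]; rewrite lee_fin /T; case: ifP => // _.
  by rewrite !mulr_ge0 ?exprn_ge0 ?invr_ge0 ?subr_ge0 ?wmini_ge0.
transitivity (\int[leb]_(x in `[0%R, L]) (\sum_(s < (size y).+1)
    \sum_(i < (size y).+1) (T s i x)%:E))%E.
  apply: eq_integral => x _; rewrite /B wbucketE -sumEFin; apply: eq_bigr => s _.
  by rewrite big_mkcond -sumEFin.
rewrite ge0_integral_sum//; last 2 first.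
- by move=> s; apply: emeasurable_sum => i; exact: mT.
- by move=> s x x0L; apply: sume_ge0 => i _; exact: T0.
rewrite /wavg mulr_sumr -sumEFin; apply: eq_bigr => s _.
rewrite ge0_integral_sum//; last by move=> i x; exact: T0.
rewrite [in RHS]big_mkcond mulr_sumr -sumEFin; apply: eq_bigr => i _.
have [is_le|nis] := boolP (i + s <= size y)%N; last first.
  by rewrite mulr0 integral0_eq// => x _; rewrite /T (negbTE nis).
transitivity (\int[leb]_(x in `[0%R, L])
    ((x ^+ i / i`!%:R * ((L - x) ^+ (size y - s - i) / (size y - s - i)`!%:R))%:E *
    (wmini X M (take s (drop i y)))%:E))%E.
  by apply: eq_integral => x _; rewrite /T is_le EFinM.
rewrite ge0_integralZr//; last 3 first.
- apply: measurable_funTS; apply/measurable_EFinP; apply: measurable_funM.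
    by apply: measurable_funM; [exact: measurable_funX|exact: measurable_cst].
  apply: measurable_funM; last exact: measurable_cst.
  by apply: measurable_funX; apply: measurable_funB.
- move=> x; rewrite /= in_itv/= => /andP[x0 xL].
  by rewrite lee_fin !mulr_ge0 ?exprn_ge0 ?invr_ge0 ?subr_ge0.
- by rewrite lee_fin wmini_ge0.
rewrite integral_exp_fact// -EFinM (_ : (i + (size y - s - i) = size y - s)%N).
  by rewrite exprS !mulrA.
by lia.
Qed.

(** Stated for combinations of words, since fixing the first offset turns one word into all its
    suffixes; absolute values keep the coefficients nonnegative. [F] is prescribed only for offsets
    in [0, L], which have probability 1. *)
Lemma iid_mean_wbuckets n (F : n.-tuple R -> \bar R) (fam : seq (R * seq bool)) :
  (forall x, 0 <= F x)%E ->
  (forall x : n.-tuple R, all (fun t => 0 <= t <= L) x ->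
    F x = (\sum_(z <- fam) `|z.1| * wbuckets X L M x z.2)%:E) ->
  iid_mean U F = (\sum_(z <- fam) `|z.1| * wpow n (wavg X L M) z.2)%:E.
Proof.
elim: n F fam => [|n IH] F fam F0 FE /=; first exact: FE.
pose G t : R := \sum_(z <- fam) \sum_(i < (size z.2).+1)
  B t (take i z.2) * (`|z.1| * wpow n (wavg X L M) (drop i z.2)).
have step t : 0 <= t <= L ->
    iid_mean U (fun s : n.-tuple R => F [tuple of t :: s]) = (G t)%:E.
  (* The first bucket takes a prefix, whose mass joins the coefficient; the suffix remains. *)
  move=> t0L; pose fam' := [seq (z.1 * B t (take i z.2), drop i z.2)
    | z <- fam, i <- index_iota 0 (size z.2).+1].
  rewrite (IH _ fam')//.
    congr _%:E; rewrite /fam' big_allpairs_dep; apply: eq_bigr => z _.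
    rewrite big_mkord; apply: eq_bigr => i _ /=.
    by rewrite normrM (ger0_norm (wbucket_ge0 _ _ t0L M_ge0)) mulrAC mulrC.
  move=> x x0L; rewrite FE /=; last by rewrite t0L.
  congr _%:E; rewrite /fam' big_allpairs_dep; apply: eq_bigr => z _.
  rewrite big_mkord mulr_sumr; apply: eq_bigr => i _ /=.
  by rewrite normrM (ger0_norm (wbucket_ge0 _ _ t0L M_ge0)) mulrA.
have wpow0 u : 0 <= wpow n (wavg X L M) u.
  rewrite /wpow; elim: (n) u => [|n' IHn] u /=; first by rewrite /wone.
  apply: wconv_ge0 => // v; apply: sumr_ge0 => s _; apply: sumr_ge0 => i _.
  by rewrite !mulr_ge0 ?exprn_ge0 ?invr_ge0 ?wmini_ge0// ltW.
pose g (t : measurableTypeR R) : \bar R := if 0 <= t <= L then (G t)%:E else 0%E.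
have mB u : measurable_fun setT (fun t : measurableTypeR R => B t u) by [].
have mG : measurable_fun setT (fun t : measurableTypeR R => (G t)%:E).
  apply/measurable_EFinP; apply: measurable_sum => z; apply: measurable_sum => i.
  by apply: measurable_funM => //; exact: measurable_cst.
have mg : measurable_fun setT g.
  apply: measurable_fun_ifT => //.
  by apply: measurable_and; exact: measurable_fun_ler.
have G0 t : 0 <= t <= L -> 0 <= G t.
  move=> t0L; apply: sumr_ge0 => z _; apply: sumr_ge0 => i _.
  by rewrite mulr_ge0 ?wbucket_ge0// mulr_ge0.
have g0 t : (0 <= g t)%E by rewrite /g; case: ifPn => // t0L; rewrite lee_fin G0.
have mitv : measurable (`[0%R, L]%classic : set (measurableTypeR R)).
  exact: measurable_itv.
transitivity (\int[U]_t g t)%E.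
  apply: (@ge0_integral_eq_off_null _ _ _ U (~` `[0%R, L]%classic)) => //.
  - exact: measurableC.
  - have U1 : U `[0%R, L]%classic = 1%E by exact: integral_uniform_pdf1.
    by have := @probability_setC _ _ _ U _ mitv; rewrite U1 subee.
  - by move=> t; apply: iid_mean_ge0 => x; exact: F0.
  - by move=> t /contrapT /=; rewrite in_itv/= => t0L; rewrite step// /g t0L.
rewrite integral_uniform//.
transitivity (((L - 0)^-1)%:E * (\sum_(z <- fam) \sum_(i < (size z.2).+1)
    \int[leb]_(t in `[0%R, L]) ((B t (take i z.2))%:E *
      (`|z.1| * wpow n (wavg X L M) (drop i z.2))%:E)))%E.
  congr (_ * _)%E; transitivity (\int[leb]_(t in `[0%R, L])
    (\sum_(z <- fam) \sum_(i < (size z.2).+1) ((B t (take i z.2))%:E *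
      (`|z.1| * wpow n (wavg X L M) (drop i z.2))%:E)))%E.
    apply: eq_integral => t; rewrite inE/= in_itv/= => t0L; rewrite /g t0L /G.
    by rewrite -sumEFin; apply: eq_bigr => z _; rewrite -sumEFin.
  have term0 (t : R) z (i : nat) : `[0%R, L]%classic t ->
      (0 <= (B t (take i z.2))%:E *
      (`|z.1| * wpow n (wavg X L M) (drop i z.2))%:E)%E.
    rewrite /= in_itv/= => t0L; rewrite -EFinM lee_fin mulr_ge0 ?wbucket_ge0//.
    by rewrite mulr_ge0.
  have mterm z (i : nat) : measurable_fun (`[0%R, L]%classic : set (measurableTypeR R))
      (fun t : measurableTypeR R => ((B t (take i z.2))%:E *
      (`|z.1| * wpow n (wavg X L M) (drop i z.2))%:E)%E).
    apply: measurable_funTS; apply: emeasurable_funM => //.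
    exact/measurable_EFinP.
  rewrite ge0_integral_sum//; last 2 first.
  - by move=> z; apply: emeasurable_sum => i; exact: mterm.
  - by move=> z t t0L; apply: sume_ge0 => i _; exact: term0.
  apply: eq_bigr => z _; rewrite ge0_integral_sum// => i t; exact: term0.
have L0 : L != 0 by rewrite gt_eqF.
rewrite subr0; transitivity (((L^-1)%:E * (\sum_(z <- fam) \sum_(i < (size z.2).+1)
    (L * wavg X L M (take i z.2) *
      (`|z.1| * wpow n (wavg X L M) (drop i z.2)))%:E)))%E.
  congr (_ * _)%E; apply: eq_bigr => z _; apply: eq_bigr => i _.
  rewrite ge0_integralZr//.
  - by rewrite integral_wbucket -EFinM.
  - by apply: measurable_funTS; exact/measurable_EFinP.
  - by move=> t; rewrite /= in_itv/= => t0L; rewrite lee_fin wbucket_ge0.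
  - by rewrite lee_fin mulr_ge0.
transitivity ((L^-1)%:E * (\sum_(z <- fam) \sum_(i < (size z.2).+1)
    L * wavg X L M (take i z.2) *
      (`|z.1| * wpow n (wavg X L M) (drop i z.2)))%:E)%E.
  by rewrite -sumEFin; congr (_ * _)%E; apply: eq_bigr => z _; rewrite -sumEFin.
rewrite -EFinM; congr _%:E.
rewrite mulr_sumr; apply: eq_bigr => z _; rewrite /= /wconv !mulr_sumr.
by apply: eq_bigr => i _; field.
Qed.

End offsets.

Lemma ordering_prob_ge0 (R : realType) (m : R)
    (p q : probability (measurableTypeR R) R) y : (0 <= ordering_prob m p q y)%E.
Proof.
rewrite /ordering_prob; apply: nneseries_ge0 => i _ _.
apply: nneseries_ge0 => j _ _; apply: mule_ge0.
  by rewrite lee_fin mulr_ge0 ?poisson_pmf_ge0.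
by apply: iid_mean_ge0 => us; apply: iid_mean_ge0 => vs; rewrite lee_fin.
Qed.

Lemma joint_pmfE (R : realType) (k : nat) (eps m : R)
    (k_gt0 : (0 < k)%N) (eps01 : 0 < eps < 1)
    (p q : bool -> k.-tuple R -> probability (measurableTypeR R) R) X y :
  0 < m ->
  (forall x : k.-tuple R, (forall i : 'I_k, 0 <= tnth x i <= (1 - eps) / k%:R) ->
     bucketed eps X x (p X x) (q X x)) ->
  joint_pmf m k_gt0 eps01 p q X y =
  2^-1 * (expR (- (2 * m)) * m ^+ size y *
    wpow k (wavg X ((1 - eps) / k%:R) (eps / k%:R)) y).
Proof.
move=> m0 H; rewrite /joint_pmf.
have M0 : 0 <= eps / k%:R by rewrite divr_ge0//; case/andP: eps01 => /ltW.
set c := expR _ * _; have c0 : 0 <= c by rewrite mulr_ge0 ?expR_ge0// exprn_ge0// ltW.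
rewrite (iid_mean_wbuckets (X := X) (offset_bound_gt0 k_gt0 eps01) M0
  (fam := [:: (c, y)])).
- by rewrite big_seq1 ger0_norm.
- by move=> x; exact: ordering_prob_ge0.
- move=> x xL.
  have bx : bucketed eps X x (p X x) (q X x).
    by apply: H => i; exact: (allP xL _ (mem_tnth i x)).
  rewrite big_seq1 ger0_norm// (ordering_prob_bucketed _ _ m0 bx)//.
  by case: bx.
Qed.

(** * Mutual information *)

Section pattern_laws.
Variable R : realType.
Implicit Types (f : seq bool -> R).

Lemma wpow_scale (c x : R) f k y :
  wpow k (fun u => c * x ^+ size u * f u) y = c ^+ k * x ^+ size y * wpow k f y.
Proof.
elim: k y => [|k IH] y.
  by rewrite /wpow /= /wone; case: y => [|l y]; rewrite ?mulr0// !expr0 !mulr1.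
rewrite [LHS]/= (eq_wconv _ (frefl _) IH) wconv_scale exprS.
by congr (_ * _).
Qed.

Lemma wsum_wpow (A B : R) f : (forall n, wsum n f = A * (B ^+ n / n`!%:R)) ->
  forall k n, wsum n (wpow k f) = A ^+ k * ((k%:R * B) ^+ n / n`!%:R).
Proof.
move=> fE; elim=> [|k IH] n.
  rewrite mul0r mul1r; case: n => [|n] /=; first by rewrite /wone divr1 expr0.
  by rewrite !(eq_wsum (g := fun=> 0)) ?wsum_cst ?mulr0 ?addr0 ?expr0n ?mul0r.
rewrite wsum_wconv -natr1 mulrDl mul1r addrC -sum_exp_conv mulr_sumr.
by apply: eq_bigr => i _; rewrite fE IH exprS; ring.
Qed.

Let esum_size n f : (forall y, 0 <= f y) ->
  (\esum_(y in [set y : seq bool | size y = n]) (f y)%:E = (wsum n f)%:E)%E.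
Proof.
elim: n f => [|n IH] f f0.
  rewrite (_ : [set y | _] = [set [::]]).
    by rewrite esum_set1// lee_fin.
  by apply/seteqP; split => [y /= /size0nil|y ->].
pose T l := [set l :: y | y in [set y : seq bool | size y = n]].
rewrite (esumID (T true)); last by move=> y _; rewrite lee_fin.
have -> : [set y : seq bool | size y = n.+1] `&` T true = T true.
  apply/seteqP; split => [y []//|y Ty]; split=> //.
  by case: Ty => u <- <-.
have -> : [set y : seq bool | size y = n.+1] `&` ~` T true = T false.
  apply/seteqP; split => y.
    by move=> [] /=; case: y => [//|[] y] [yn] H; [case: H; exists y|exists y].
  by move=> [u un <-]; split; [rewrite /= un|move=> -[v _]].
have inj l : set_inj [set y : seq bool | size y = n] (cons l).
  by move=> u v _ _ [].
by rewrite !esum_image// !IH.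
Qed.

Lemma esum_words f : (forall y, 0 <= f y) ->
  (\esum_(y in [set: seq bool]) (f y)%:E = \sum_(0 <= n <oo) (wsum n f)%:E)%E.
Proof.
move=> f0; pose F n := [set y : seq bool | size y = n].
have tF : trivIset setT F.
  apply/trivIsetP => i j _ _ ij; apply/seteqP; split => // y [/= yi yj].
  by move/eqP: ij; rewrite -yi -yj.
have -> : [set: seq bool] = \bigcup_n F n.
  by apply/seteqP; split => // y _; exists (size y).
rewrite (nneseries_sum_bigcup tF); last by move=> y; rewrite lee_fin.
by apply: eq_eseriesr => n _; exact: esum_size.
Qed.

Lemma esum_words_le f (B : R) : (forall y, 0 <= f y) ->
  (forall N, \sum_(n < N) wsum n f <= B) ->
  (\esum_(y in [set: seq bool]) (f y)%:E <= B%:E)%E.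
Proof.
move=> f0 fB; rewrite esum_words//; apply: lime_le.
  by apply: is_cvg_nneseries => n _ _; rewrite lee_fin; exact: wsum_ge0.
by apply: nearW => N; rewrite big_mkord sumEFin lee_fin.
Qed.

Lemma esum_words_poisson f (c x : R) : (forall y, 0 <= f y) ->
  (forall n, wsum n f = c * (x ^+ n / n`!%:R)) ->
  (\esum_(y in [set: seq bool]) (f y)%:E = (c * expR x)%:E)%E.
Proof.
move=> f0 fE; rewrite esum_words//; apply/cvg_lim => //.
rewrite (_ : (fun _ => _) = EFin \o (fun N => c * series (exp_coeff x) N)).
  apply: cvg_EFin; first by apply: nearW.
  by apply: cvgM; [exact: cvg_cst|exact: is_cvg_series_exp_coeff].
by apply/funext => N; rewrite sumEFin /= /series /= mulr_sumr;
  congr _%:E; apply: eq_bigr => n _; rewrite fE.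
Qed.

End pattern_laws.

(** * Information carried by one pattern about a fair bit *)

Section information.
Variable R : realType.

Lemma mul_ln_div_le (x q : R) : 0 <= x -> 0 < q -> x * ln (x / q) <= x * (x / q - 1).
Proof.
move=> x0 q0; have [->|xn0] := eqVneq x 0; first by rewrite !mul0r.
have xp : 0 < x by rewrite lt_neqAle eq_sym xn0.
rewrite ler_pM2l//; have := @le_ln1Dx R (x / q - 1).
have t0 : 0 < x / q by exact: divr_gt0.
by rewrite [1 + _]addrC subrK; apply; lra.
Qed.

(** Here [a] and [b] are the likelihoods of one pattern under the two values of the bit. Applying ln
    t <= t - 1 to their ratios to the mixture (a + b) / 2 gives the triangular discrimination. *)
Lemma info_le (a b : R) : 0 <= a -> 0 < b ->
  a / 2 * ln (a / 2 / (2^-1 * (a / 2 + b / 2))) +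
  b / 2 * ln (b / 2 / (2^-1 * (a / 2 + b / 2))) <= (a - b) ^+ 2 / (2 * (a + b)).
Proof.
move=> a0 b0; have ab : 0 < a + b by exact: ltr_wpDl.
have E (z : R) : z / 2 / (2^-1 * (a / 2 + b / 2)) = z / ((a + b) / 2).
  by field; rewrite gt_eqF.
rewrite !E; have q0 : 0 < (a + b) / 2 by exact: divr_gt0.
have ha := mul_ln_div_le a0 q0; have hb := mul_ln_div_le (ltW b0) q0.
have -> : (a - b) ^+ 2 / (2 * (a + b)) = (a * (a / ((a + b) / 2) - 1)) / 2 +
    (b * (b / ((a + b) / 2) - 1)) / 2 by field; rewrite gt_eqF.
lra.
Qed.

End information.

Lemma wpow_gt0 (R : realType) (f : seq bool -> R) k y :
  (forall u, 0 < f u) -> 0 < wpow k.+1 f y.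
Proof.
move=> f0; have f1 u : 0 <= f u by exact: ltW.
have fnil j : 0 < wpow j f [::].
  elim: j => [|j IH]; first by rewrite /wpow /= /wone.
  by rewrite /wpow /= /wconv /= big_ord1 mulr_gt0.
rewrite /wpow /= /wconv big_ord_recr /= drop_size.
apply: ltr_wpDl; last exact: mulr_gt0 (f0 _) (fnil k).
by apply: sumr_ge0 => i _; rewrite mulr_ge0 ?wpow_ge0.
Qed.

(** * Chi-square and information bounds for the whole pattern *)

Section pattern_chi2.
Variables (R : realType) (k : nat) (eps m : R).
Hypotheses (k_gt0 : (0 < k)%N) (eps01 : 0 < eps < 1) (m_gt0 : 0 < m).
Hypotheses (k_le : 18 * k%:R <= m) (m_eps : m * eps <= k%:R / 18).

Let avg X : seq bool -> R := wavg X ((1 - eps) / k%:R) (eps / k%:R).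
Let lam := m / k%:R.
Let kR : 0 < (k%:R : R). Proof. by rewrite ltr0n. Qed.
Let lam0 : 0 < lam. Proof. exact: divr_gt0. Qed.
Let fact0 n : (n`!%:R : R) != 0. Proof. by rewrite pnatr_eq0 -lt0n fact_gt0. Qed.

(** Law of Y given the bit, averaged over the offsets. *)
Definition pattern_law X y : R := expR (- (2 * m)) * m ^+ size y * wpow k (avg X) y.

Let bucket_law X y : R := expR (- (2 * lam)) * m ^+ size y * avg X y.

(** The prefactor is shared among the buckets: exp (- 2 m) is the k-th power of exp (- 2 lam), and
    m^|y| is multiplicative for concatenation. *)
Let pattern_lawE X y : pattern_law X y = wpow k (bucket_law X) y.
Proof.
rewrite wpow_scale -expRM_natl; congr (expR _ * _ * _).
by rewrite /lam; field; rewrite gt_eqF.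
Qed.

Let avg_ge0 X y : 0 <= avg X y.
Proof.
apply: sumr_ge0 => s _; apply: sumr_ge0 => i _; case/andP: eps01 => e0 e1.
by rewrite mulr_ge0 ?wmini_ge0 ?divr_ge0 ?exprn_ge0 ?divr_ge0 ?subr_ge0 ?ltW.
Qed.

Let bucket_law_ge0 X y : 0 <= bucket_law X y.
Proof. by rewrite !mulr_ge0 ?expR_ge0// exprn_ge0// ltW. Qed.

Let bucket_law1 y :
  bucket_law true y = expR (- (2 * lam)) * (lam ^+ size y / (size y)`!%:R).
Proof.
rewrite /bucket_law /avg wavg_common// /wcommon /lam expr_div_n exprVn.
by ring.
Qed.

Let bucket_law1_gt0 y : 0 < bucket_law true y.
Proof.
by rewrite bucket_law1 mulr_gt0 ?expR_gt0// divr_gt0 ?exprn_gt0// ltr0n fact_gt0.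
Qed.

Let bucket_law0 y :
  bucket_law false y = bucket_law true y * (1 + bucket_dev eps y).
Proof. by rewrite /bucket_law /avg wavg_dev// wavg_common// !mulrA. Qed.

Let wsum_bucket_law X n :
  wsum n (bucket_law X) = expR (- (2 * lam)) * ((2 * lam) ^+ n / n`!%:R).
Proof.
set c := expR (- (2 * lam)) * (lam ^+ n / n`!%:R).
have cE : expR (- (2 * lam)) * ((2 * lam) ^+ n / n`!%:R) = 2 ^+ n * c.
  by rewrite /c exprMn; ring.
case: X.
  by rewrite cE -wsum_cst; apply: eq_wsum => y yn; rewrite bucket_law1 yn.
rewrite (eq_wsum (g := fun y => c + c * bucket_dev eps y)).
  by rewrite wsumD wsum_cst wsumZ wsum_bucket_dev// mulr0 addr0.
by move=> y yn; rewrite bucket_law0 bucket_law1 yn mulrDr mulr1.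
Qed.

Lemma pattern_law_ge0 X y : 0 <= pattern_law X y.
Proof. by rewrite pattern_lawE wpow_ge0. Qed.

Lemma pattern_law1_gt0 y : 0 < pattern_law true y.
Proof.
rewrite pattern_lawE -(prednK k_gt0); apply: wpow_gt0.
exact: bucket_law1_gt0.
Qed.

Lemma esum_pattern_law X c : 0 <= c ->
  (\esum_(y in [set: seq bool]) (c * pattern_law X y)%:E = c%:E)%E.
Proof.
move=> c0; rewrite (@esum_words_poisson R _ (c * expR (- (2 * m))) (2 * m)).
- by rewrite -mulrA -expRD addNr expR0 mulr1.
- by move=> y; rewrite mulr_ge0// pattern_law_ge0.
move=> n; rewrite wsumZ (eq_wsum (fun y _ => pattern_lawE X y)).
rewrite (wsum_wpow (@wsum_bucket_law X)) -expRM_natl -mulrA; congr (_ * (expR _ * (_ ^+ _ / _))).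
  by rewrite /lam; field; rewrite gt_eqF.
by rewrite /lam; field; rewrite gt_eqF.
Qed.

Let C0 : R := 4 ^+ 7 * 120 * expR 6.

Let eta := C0 * lam ^+ 5 * eps ^+ 6.

Lemma pattern_chi2_le N :
  \sum_(n < N) wsum n
    (fun y => (pattern_law false y - pattern_law true y) ^+ 2 / pattern_law true y)
  <= (1 + eta) ^+ k - 1.
Proof.
under eq_bigr => n _ do under eq_wsum => y _ do rewrite !pattern_lawE.
apply: (wpow_chi2_le (h0 := bucket_law false) (h1 := bucket_law true)
  (phi := fun n => expR (- (2 * lam)) * ((2 * lam) ^+ n / n`!%:R))).
- by move=> y; exact: bucket_law_ge0.
- by move=> y h; have := bucket_law1_gt0 y; rewrite h ltxx.
- by move=> n; exact: wsum_bucket_law.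
- by move=> n; exact: wsum_bucket_law.
- move=> M; rewrite -mulr_sumr expRN mulrC ler_pdivrMr ?expR_gt0// mul1r.
  by apply: sum_exp_coeff_le; rewrite mulr_ge0// ltW.
move=> M; have lamge : 18 <= lam by rewrite ler_pdivlMr.
have lameps : lam * eps <= 1 / 18.
  by rewrite /lam mulrAC ler_pdivrMr//; apply: le_trans m_eps _; lra.
apply: le_trans (poisson_bucket_dev_le eps01 lamge lameps M).
apply: ler_sum => n _; rewrite mulrA -wsumZ; apply: ler_wsum => y yn.
rewrite bucket_law0; have h1 := bucket_law1_gt0 y.
have -> : (bucket_law true y * (1 + bucket_dev eps y) - bucket_law true y) ^+ 2 /
    bucket_law true y = bucket_law true y * bucket_dev eps y ^+ 2.
  by field; rewrite gt_eqF.
by rewrite bucket_law1 yn.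
Qed.

Lemma pattern_information_le (J : bool -> seq bool -> R) :
  (forall X y, J X y = 2^-1 * pattern_law X y) ->
  (mutual_information J <=
   (2 * C0 * m ^+ 5 * eps ^+ 6 / k%:R ^+ 4)%:E)%E.
Proof.
move=> JE.
have half : 0 <= 2^-1 :> R by rewrite invr_ge0.
have fstE X : marginal_fst J X = 2^-1.
  rewrite /marginal_fst (eq_esum (b := fun y => (2^-1 * pattern_law X y)%:E)).
    by rewrite esum_pattern_law.
  by move=> y _; rewrite JE.
pose a := pattern_law false; pose b := pattern_law true.
have a0 y : 0 <= a y by exact: pattern_law_ge0.
have b0 y : 0 < b y by exact: pattern_law1_gt0.
have termE y : \sum_(X : bool) J X y * ln (J X y / (marginal_fst J X * marginal_snd J y))
    <= (a y - b y) ^+ 2 / (2 * (a y + b y)).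
  rewrite /marginal_snd !big_bool /= !fstE !JE -/(a y) -/(b y).
  apply: le_trans (info_le (a0 y) (b0 y)).
  by rewrite !(mulrC 2^-1 (a y)) !(mulrC 2^-1 (b y)) addrC (addrC (b y / 2)).
have kEta : k%:R * eta = C0 * m ^+ 5 * eps ^+ 6 / k%:R ^+ 4.
  by rewrite /eta /lam; field; rewrite gt_eqF.
have eta0 : 0 <= eta.
  rewrite /eta /C0; case/andP: eps01 => e0 _.
  by rewrite !mulr_ge0 ?exprn_ge0 ?expR_ge0 ?divr_ge0 ?(ltW e0) ?(ltW m_gt0).
have -> : 2 * C0 * m ^+ 5 * eps ^+ 6 / k%:R ^+ 4 = 2 * (k%:R * eta).
  by rewrite kEta; ring.
have [small|large] := leP (k%:R * eta) (1 / 2).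
  (* As 2 (a + b) >= b, the information is at most the chi-square distance. *)
  apply: (@le_trans _ _ (\esum_(y in [set: seq bool]) ((a y - b y) ^+ 2 / b y)%:E)%E).
    apply: le_esum => y _; rewrite lee_fin; apply: le_trans (termE y) _.
    rewrite ler_wpM2l ?sqr_ge0// lef_pV2 ?posrE//.
      by have := a0 y; have := b0 y; lra.
    by have := a0 y; have := b0 y; lra.
  apply: esum_words_le => [y|N]; first by rewrite divr_ge0 ?sqr_ge0// ltW.
  apply: le_trans (pattern_chi2_le N) _.
  (* The chain is (1 + eta)^k <= exp (k eta) <= 1 + 2 k eta. *)
  have : (1 + eta) ^+ k <= expR (k%:R * eta).
    rewrite expRM_natl lerXn2r ?nnegrE ?expR_ge0 ?expR_ge1Dx//; lra.
  have ke0 : 0 <= k%:R * eta by rewrite mulr_ge0.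
  have := @expR_le_1D2x R (k%:R * eta); rewrite ke0 small => /(_ isT); lra.
(* Since (a - b)^2 <= (a + b)^2, each term is at most (a + b) / 2. The information is thus at most
   1, which is below 2 k eta. *)
apply: (@le_trans _ _ (\esum_(y in [set: seq bool])
    ((2^-1 * a y)%:E + (2^-1 * b y)%:E))%E).
  apply: le_esum => y _; rewrite -EFinD lee_fin; apply: le_trans (termE y) _.
  have := a0 y; have := b0 y => b1 a1; rewrite ler_pdivrMr; last by lra.
  nra.
rewrite esumD; last 2 first.
- by move=> y _; rewrite lee_fin mulr_ge0.
- by move=> y _; rewrite lee_fin mulr_ge0// ltW.
rewrite !esum_pattern_law// -EFinD lee_fin; lra.
Qed.

End pattern_chi2.

Theorem theorem4p5 (R : realType) :
  exists c C' : R, [/\ 0 < c, 0 < C' &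
    forall (k : nat) (eps m : R)
        (k_gt0 : (0 < k)%N) (eps01 : 0 < eps < 1) (m_gt0 : 0 < m)
        (p q : bool -> k.-tuple R -> probability (measurableTypeR R) R),
      (forall (X : bool) (x : k.-tuple R),
         (forall i : 'I_k, 0 <= tnth x i <= (1 - eps) / k%:R) ->
         bucketed eps X x (p X x) (q X x)) ->
      m * eps <= c * k%:R ->
      ln (m * k%:R / eps) <= c / eps ->
      k%:R <= c * m ->
      (mutual_information (joint_pmf m k_gt0 eps01 p q)
         <= (C' * m ^+ 5 * eps ^+ 6 / k%:R ^+ 4)%:E)%E].
Proof.
(* c = 1/18 gives lam >= 18 and lam eps <= 1/18, hence theta <= 1/2 and the exponent 6. In C', the
   leading 2 is that of 2 k eta. *)
exists 18^-1, (2 * (4 ^+ 7 * 120 * expR 6)).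
split; [by rewrite invr_gt0| |].
  by rewrite !mulr_gt0 ?expR_gt0 ?exprn_gt0.
move=> k eps m k_gt0 eps01 m_gt0 p q H m_eps _ k_m.
apply: pattern_information_le => //; [lra|lra|].
by move=> X y; rewrite joint_pmfE//; exact: H.
Qed.
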